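(* Let $d\geq 3$ and let $\rho$ be an admissible weight on $\mathbb{R}^d$, $H=L^2_\rho(\mathbb{R}^d)$. Let $f,\sigma:\mathbb{R}^d\times\mathbb{R}\to\mathbb{R}$ be measurable functions such that: 1. there are constants $c>0$ and $\sigma_0>0$ with $|\sigma(x,u_1)-\sigma(x,u_2)|\leq c|u_1-u_2|$ and $|\sigma(x,u)|\leq \sigma_0$ for all $x\in\mathbb{R}^d$, $u,u_1,u_2\in\mathbb{R}$; 2. there is a constant $c>0$ with $|f(x,u_1)-f(x,u_2)|\leq c|u_1-u_2|$ for all $x\in\mathbb{R}^d$, $u_1,u_2\in\mathbb{R}$, and there exists $\varphi\in L^1(\mathbb{R}^d)\cap L^\infty(\mathbb{R}^d)$ such that $|f(x,u)|\leq\varphi(x)$ for all $(x,u)\in\mathbb{R}^d\times\mathbb{R}$. Let $u(t,x)$ be a (mild) solution of $$\frac{\partial}{\partial t}u(t,x)=\Delta u(t,x)+f(x,u(t,x))+\sigma(x,u(t,x))\,\dot W(t,x),\quad t>0,\ x\in\mathbb{R}^d,$$ with initial datum satisfying $\mathbb{E}\|u(0,\cdot)\|^2_{L^2(\mathbb{R}^d)}<\infty$. Then $$\sup_{t\geq 0}\mathbb{E}\|u(t,\cdot)\|_H^2<\infty .$$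
   Context: Admissible weight: a non-negative function $\rho\in L^1(\mathbb{R}^d)\cap L^\infty(\mathbb{R}^d)$, continuous, such that for every $T>0$ there is $C(T)>0$ with $G(t,\cdot)*\rho\leq C(T)\rho$ for all $t\in[0,T]$, where $G(t,x)=(4\pi t)^{-d/2}e^{-|x|^2/(4t)}$ is the heat kernel. Weighted space: $L^2_\rho(\mathbb{R}^d)=\{w:\mathbb{R}^d\to\mathbb{R}:\int_{\mathbb{R}^d}|w(x)|^2\rho(x)\,dx<\infty\}$ with $\|w\|_H^2=\int_{\mathbb{R}^d}|w(x)|^2\rho(x)\,dx$. Noise: $\{e_k\}_{k\geq1}$ is an orthonormal basis of $L^2(\mathbb{R}^d)$ with $\sup_k\|e_k\|_{L^\infty(\mathbb{R}^d)}\leq 1$; $a_k\ge 0$ with $a=\sum_k a_k<\infty$; $\beta_k$ are independent standard one-dimensional Wiener processes on $t\geq0$ on a probability space $(\Omega,\mathcal{F},P)$; $W(t,x)=\sum_{k\geq1}\sqrt{a_k}\,\beta_k(t)e_k(x)$. $(\mathcal{F}_t)$ is a right-continuous filtration to which $W$ is adapted and such that $W(t)-W(s)$ is independent of $\mathcal{F}_s$ for all $s<t$. Mild solution: an $\mathcal{F}_t$-adapted random process $u(t,\cdot)\in H$ (in particular $u(0,\cdot)$ is $\mathcal{F}_0$-measurable) with, for $t\geq0$, $$u(t,\cdot)=S(t)u(0,\cdot)+\int_0^tS(t-s)f(\cdot,u(s,\cdot))\,ds+\int_0^tS(t-s)\sigma(\cdot,u(s,\cdot))\,dW(s,\cdot),$$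 where $S(t)v(x)=\int_{\mathbb{R}^d}G(t,x-y)v(y)\,dy$ and the stochastic integral means $\sum_k\sqrt{a_k}\int_0^tS(t-s)[\sigma(\cdot,u(s,\cdot))e_k]\,d\beta_k(s)$. *)

(* Defs.v *)
From HB Require Import structures.
From mathcomp Require Import all_boot all_order all_algebra.
From mathcomp Require Import all_classical all_reals all_analysis.
From mathcomp Require Import measurable_realfun.

Set Implicit Arguments.
Unset Strict Implicit.
Unset Printing Implicit Defensive.
Import Order.TTheory GRing.Theory Num.Theory.
Import numFieldNormedType.Exports.

Local Open Scope classical_set_scope.
Local Open Scope ring_scope.

(* R^n is 'rV[R]_n, with the product sigma-algebra (the Borel one of its
   topology); its library norm is the sup norm, so Euclidean norms are written
   out. *)
Definition rowvec_display : measure_display -> measure_display.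
Proof. exact. Qed.

Section measurable_rowvec.
Context {d} {T : sigmaRingType d} (n : nat).

Definition coor (i : 'I_n) (x : 'rV[T]_n) : T := x ord0 i.

Let rowvec0 : g_sigma_preimage coor set0.
Proof. exact: sigma_algebra0. Qed.

Let rowvecC A : g_sigma_preimage coor A -> g_sigma_preimage coor (~` A).
Proof. exact: sigma_algebraC. Qed.

Let rowvec_bigcup (F : _^nat) : (forall i, g_sigma_preimage coor (F i)) ->
  g_sigma_preimage coor (\bigcup_i (F i)).
Proof. exact: sigma_algebra_bigcup. Qed.

HB.instance Definition _ := @isMeasurable.Build (rowvec_display d)
  'rV[T]_n (g_sigma_preimage coor) rowvec0 rowvecC rowvec_bigcup.

End measurable_rowvec.

Lemma measurable_coor d (T : sigmaRingType d) n (i : 'I_n) :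
  measurable_fun [set: 'rV[T]_n] (coor i).
Proof.
move=> _ Y mY; rewrite setTI; apply: sub_sigma_algebra => /=.
rewrite -bigcup_seq/=; exists i => /=; first by rewrite mem_index_enum.
by exists Y => //; rewrite setTI.
Qed.

Lemma measurable_fun_coorP d1 d2 (T1 : measurableType d1)
    (T2 : measurableType d2) n (f : T1 -> 'rV[T2]_n) :
  (forall i, measurable_fun [set: T1] (coor i \o f)) ->
  measurable_fun [set: T1] f.
Proof.
move=> mf _ A.
have : g_sigma_preimage (@coor d2 T2 n) `<=`
    [set A | measurable (f @^-1` A)].
  apply: smallest_sub.
    split => /=.
    - by rewrite preimage_set0.
    - by move=> B /= mB; rewrite setTD preimage_setC; exact: measurableC.
    - by move=> B /= mB; rewrite preimage_bigcup; exact: bigcupT_measurable.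
  move=> B; rewrite -bigcup_seq/= => -[i _ [C mC <-]] /=.
  by rewrite setTI -comp_preimage -[X in measurable X]setTI; exact: mf.
by move=> h /h /=; rewrite setTI.
Qed.

Lemma product_measure_sigma_finite d1 d2 (T1 : measurableType d1)
    (T2 : measurableType d2) (R : realType)
    (m1 : {sigma_finite_measure set T1 -> \bar R})
    (m2 : {sigma_finite_measure set T2 -> \bar R}) :
  sigma_finite setT (m1 \x m2)%E.
Proof.
have /sigma_finiteP[F [TF ndF Foo]] := sigma_finiteT m1.
have /sigma_finiteP[G [TG ndG Goo]] := sigma_finiteT m2.
exists (fun n => F n `*` G n).
  rewrite -setXTT TF TG predeqE => -[x y]; split.
    move=> [/= [n _ Fnx] [k _ Gky]]; exists (maxn n k) => //; split.
    - by move: x Fnx; exact/subsetPset/ndF/leq_maxl.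
    - by move: y Gky; exact/subsetPset/ndG/leq_maxr.
  by move=> [n _ []/= ? ?]; split; exists n.
move=> k; have [? ?] := Foo k; have [? ?] := Goo k.
split; first exact: measurableX.
by rewrite product_measure1E// lte_mul_pinfty// ge0_fin_numE.
Qed.

Section lebesgue_measure_rowvec.
Context {R : realType}.

Definition consv n (p : R * 'rV[R]_n) : 'rV[R]_n.+1 :=
  \row_j (if unlift ord0 j is Some i then p.2 ord0 i else p.1).

Definition unconsv n (x : 'rV[R]_n.+1) : R * 'rV[R]_n :=
  (x ord0 ord0, \row_i x ord0 (lift ord0 i)).

Lemma consvK n : cancel (@consv n) (@unconsv n).
Proof.
move=> [a v]; rewrite /unconsv /consv; congr (_, _).
  by rewrite mxE unlift_none.
by apply/rowP => i; rewrite !mxE liftK.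
Qed.

Lemma measurable_consv n : measurable_fun [set: R * 'rV[R]_n] (@consv n).
Proof.
apply: measurable_fun_coorP => j.
rewrite /comp /coor; under eq_fun do rewrite mxE.
case: (unlift ord0 j) => [i|].
- exact: (measurableT_comp (measurable_coor i) measurable_snd).
- exact: measurable_fst.
Qed.

Lemma measurable_unconsv n : measurable_fun [set: 'rV[R]_n.+1] (@unconsv n).
Proof.
apply/measurable_fun_pairP; split; first exact: (measurable_coor ord0).
apply: measurable_fun_coorP => i.
rewrite /comp /coor; under eq_fun do rewrite mxE.
exact: (measurable_coor (lift ord0 i)).
Qed.

Section consv_measure.
Variables (n : nat) (mu : {sigma_finite_measure set 'rV[R]_n -> \bar R}).

Definition consv_measure : set 'rV[R]_n.+1 -> \bar R :=
  pushforward ((@lebesgue_measure R) \x mu)%E (@consv n).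

Let consv_measure0 : consv_measure set0 = 0%E.
Proof. by rewrite /consv_measure /pushforward preimage_set0 measure0. Qed.

Let consv_measure_ge0 A : (0 <= consv_measure A)%E.
Proof. exact: (measure_ge0 ((@lebesgue_measure R) \x mu)%E). Qed.

Let consv_measure_sigma_additive : semi_sigma_additive consv_measure.
Proof.
move=> F mF tF mUF; rewrite /consv_measure /pushforward preimage_bigcup.
apply: measure_semi_sigma_additive.
- by move=> k; rewrite -[X in measurable X]setTI; exact: measurable_consv.
- apply/trivIsetP => /= i j _ _ ij; rewrite -preimage_setI.
  by move/trivIsetP : tF => /(_ _ _ _ _ ij) ->//; rewrite preimage_set0.
- by rewrite -preimage_bigcup -[X in measurable X]setTI; exact: measurable_consv.
Qed.

HB.instance Definition _ := isMeasure.Build _ _ _ consv_measure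
  consv_measure0 consv_measure_ge0 consv_measure_sigma_additive.

Let consv_measure_sigma_finite : sigma_finite setT consv_measure.
Proof.
have [F TF Foo] := product_measure_sigma_finite (@lebesgue_measure R) mu.
exists (fun k => @unconsv n @^-1` F k).
  by rewrite -preimage_bigcup -TF preimage_setT.
move=> k; have [mF Fk] := Foo k; split.
  by rewrite -[X in measurable X]setTI; exact: measurable_unconsv.
rewrite /consv_measure /pushforward -comp_preimage.
rewrite (_ : _ \o _ = id) ?preimage_id//.
by apply/funext => x /=; rewrite consvK.
Qed.

HB.instance Definition _ := Measure_isSigmaFinite.Build _ _ _ consv_measure
  consv_measure_sigma_finite.

End consv_measure.

(* Lebesgue measure on the Borel sets of R^n: the n-fold product of the
   one-dimensional one. *)
Fixpoint lebesgue_rV n : {sigma_finite_measure set 'rV[R]_n -> \bar R} :=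
  match n with
  | 0 => \d_(0 : 'rV[R]_0)
  | m.+1 => consv_measure (lebesgue_rV m)
  end.

Lemma lebesgue_rV_box n (A : 'I_n -> set R) : (forall i, measurable (A i)) ->
  lebesgue_rV n [set x | forall i, A i (x ord0 i)] =
  (\prod_(i < n) lebesgue_measure (A i))%E.
Proof.
elim: n A => [|n IH] A mA.
  rewrite big_ord0 /= diracE mem_set//= => i.
  by case: i.
have mB : measurable [set x : 'rV[R]_n | forall i, A (lift ord0 i) (x ord0 i)].
  rewrite (_ : [set _ | _] =
      \bigcap_(i in [set: 'I_n]) (coor i @^-1` A (lift ord0 i))); last first.
    by apply/seteqP; split => [x h i _|x h i]; [exact: h|exact: (h i I)].
  apply: fin_bigcap_measurable => // i _.
  by rewrite -[X in measurable X]setTI; exact: measurable_coor.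
rewrite big_ord_recl -IH// /= /consv_measure /pushforward.
rewrite -product_measure1E//; last exact: mA.
apply: congr1.
apply/seteqP; split => [[a v] /= h|[a v] /= [h0 h] i].
  split; first by have := h ord0; rewrite mxE unlift_none.
  by move=> i; have := h (lift ord0 i); rewrite mxE liftK.
by rewrite mxE; case: unliftP => [j ->|->].
Qed.

End lebesgue_measure_rowvec.

(* For nonnegative f, the integral of the least measurable majorant: it is the
   usual integral when f is measurable, and it does not see null sets, so that
   "upint mu D f_n --> 0" is convergence in mean without any measurability
   requirement beyond the one it forces on the limit. *)
Definition upint d (T : measurableType d) (R : realType)
    (mu : set T -> \bar R) (D : set T) (f : T -> \bar R) : \bar R :=
  ereal_inf [set (\int[mu]_(x in D) h x)%E | h in
    [set h : T -> \bar R |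
      measurable_fun D h /\ forall x, D x -> (f x <= h x)%E]].

Section weighted_L2.
Context {R : realType} {d : nat}.
Local Notation Rd := 'rV[R]_d.
Local Notation leb := (lebesgue_rV d).

(* L^2(rho dx) is handled through representatives; L^2(R^d) itself is the case
   rho = cst 1. *)
Definition sqnormL2 (rho w : Rd -> R) : \bar R :=
  (\int[leb]_x (w x ^+ 2 * rho x)%:E)%E.

Definition normL2 (rho w : Rd -> R) : \bar R :=
  (sqnormL2 rho w `^ 2^-1)%E.

Definition L2 (rho : Rd -> R) : set (Rd -> R) :=
  [set w | measurable_fun setT w /\ (sqnormL2 rho w < +oo)%E].

Definition L2_open (rho : Rd -> R) (U : set (Rd -> R)) : Prop :=
  U `<=` L2 rho /\
  forall w, U w -> exists2 eps : R, 0 < eps &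
    forall v, L2 rho v -> (normL2 rho (v \- w)%R < eps%:E)%E -> U v.

Definition L2_borel (rho : Rd -> R) : set (set (Rd -> R)) :=
  <<s L2 rho, L2_open rho >>.

Definition orthonormal_basis (e : nat -> Rd -> R) : Prop :=
  [/\ forall k, L2 (cst 1) (e k),
      forall j k, \int[leb]_x (e j x * e k x) = (j == k)%:R
    & forall w, L2 (cst 1) w ->
        (fun n => normL2 (cst 1)
          (fun x => \sum_(k < n) (\int[leb]_y (w y * e k y)) * e k x - w x))
        @ \oo --> 0%E].

Definition heat_kernel (t : R) (x : Rd) : R :=
  (4 * pi * t) `^ (- (d%:R / 2)) *
  expR (- (\sum_i x ord0 i ^+ 2) / (4 * t)).

(* G(0, .) is the Dirac mass at the origin, whence S(0) = id. *)
Definition heat_semigroup (t : R) (v : Rd -> R) (x : Rd) : R :=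
  if t == 0 then v x else \int[leb]_y (heat_kernel t (x - y) * v y).

Record admissible_weight (rho : Rd -> R) : Prop := {
  admissible_ge0 : forall x, 0 <= rho x ;
  admissible_continuous : continuous rho ;
  admissible_L1 : rho \in Lfun leb 1%E ;
  admissible_Loo : rho \in Lfun leb +oo%E ;
  admissible_heat : forall T : R, 0 < T -> exists2 C : R, 0 < C &
    forall t, 0 <= t <= T -> forall x, heat_semigroup t rho x <= C * rho x }.

(* Bochner integral over [0, T] of an L^2(rho)-valued map: finite sums of
   \1_E *: w approximate the integrand in L^1(0, T; L^2(rho)). *)
Record simple_map (rho : Rd -> R) := SimpleMap {
  sm_size : nat ;
  sm_set : 'I_sm_size -> set R ;
  sm_val : 'I_sm_size -> Rd -> R ;
  sm_measurable : forall i, measurable (sm_set i) ;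
  sm_L2 : forall i, L2 rho (sm_val i) }.

Definition simple_map_fun rho (g : simple_map rho) (s : R) (x : Rd) : R :=
  \sum_(i < sm_size g) \1_(sm_set i) s * sm_val i x.

Definition simple_map_int rho (g : simple_map rho) (T : R) (x : Rd) : R :=
  \sum_(i < sm_size g)
    fine (lebesgue_measure (sm_set i `&` `[0, T])) * sm_val i x.

Definition is_bochner_integral (rho : Rd -> R) (T : R) (phi : R -> Rd -> R)
    (I : Rd -> R) : Prop :=
  [/\ forall s, 0 <= s <= T -> L2 rho (phi s), L2 rho I
    & exists g : nat -> simple_map rho,
    ((fun n => upint lebesgue_measure `[0, T]
        (fun s => normL2 rho (simple_map_fun (g n) s \- phi s)))
      @ \oo --> 0%E) /\
    ((fun n => normL2 rho (simple_map_int (g n) T \- I)) @ \oo --> 0%E)].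

End weighted_L2.

Section stochastic.
Context {R : realType} {dO : measure_display} {Omega : measurableType dO}.
Variable P : probability Omega R.

Definition mutually_independent (I : eqType) (G : I -> set (set Omega)) : Prop :=
  forall (J : seq I) (A : I -> set Omega), uniq J ->
    (forall i, i \in J -> G i (A i)) ->
    P (\bigcap_(i in [set` J]) A i) = (\prod_(i <- J) P (A i))%E.

Definition sigma_of_process (X : R -> Omega -> R) : set (set Omega) :=
  <<s \bigcup_(t in [set t | 0 <= t])
        preimage_set_system setT (X t) measurable >>.

(* Time is the half-line t >= 0; values at t < 0 are irrelevant throughout. *)
Record wiener_process (b : R -> Omega -> R) : Prop := {
  wiener_measurable : forall t, 0 <= t -> measurable_fun setT (b t) ;
  wiener_start : {ae P, forall w, b 0 w = 0} ;
  wiener_gauss : forall s t, 0 <= s < t -> forall A : set R, measurable A ->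
    P ((fun w => b t w - b s w) @^-1` A) =
    normal_prob 0 (Num.sqrt (t - s)) A ;
  wiener_increments : forall t : nat -> R, 0 <= t 0%N ->
    nondecreasing_seq t ->
    mutually_independent (fun i : nat => preimage_set_system setT
      (fun w => b (t i.+1) w - b (t i) w) measurable) ;
  wiener_continuous :
    {ae P, forall w, {within `[0, +oo[, continuous (b ^~ w)}} }.

Record right_continuous_filtration (F : R -> set (set Omega)) : Prop := {
  filtration_sigma : forall t, 0 <= t -> sigma_algebra setT (F t) ;
  filtration_sub : forall t, 0 <= t -> F t `<=` measurable ;
  filtration_le : forall s t, 0 <= s <= t -> F s `<=` F t ;
  filtration_right : forall t, 0 <= t ->
    F t = \bigcap_(s in [set s | t < s]) F s }.

Context {d : nat}.
Local Notation Rd := 'rV[R]_d.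

Definition L2_random (rho : Rd -> R) (G : set (set Omega))
    (X : Omega -> Rd -> R) : Prop :=
  (forall w, L2 rho (X w)) /\
  (forall B, L2_borel rho B -> G (X @^-1` B)).

(* W(t) = sum_k sqrt(a_k) beta_k(t) e_k, the series converging a.s. in
   L^2(R^d) (recall that sum_k a_k < oo). *)
Definition is_noise (a : nat -> R) (b : nat -> R -> Omega -> R)
    (e : nat -> Rd -> R) (W : R -> Omega -> Rd -> R) : Prop :=
  forall t, 0 <= t -> {ae P, forall w,
    (fun n => normL2 (cst 1) (fun x =>
      \sum_(k < n) Num.sqrt (a k) * b k t w * e k x - W t w x))
    @ \oo --> 0%E}.

Definition noise_adapted (F : R -> set (set Omega))
    (W : R -> Omega -> Rd -> R) : Prop :=
  (forall t, 0 <= t -> L2_random (cst 1) (F t) (W t)) /\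
  (forall s t, 0 <= s < t -> forall A B, F s A -> L2_borel (cst 1) B ->
    let Inc := (fun w => W t w \- W s w) @^-1` B in
    P (A `&` Inc) = (P A * P Inc)%E).

(* Elementary adapted L^2(rho)-valued processes: finite sums of
   \1_(]s, t] `*` A) *: v with A in F_s and v in L^2(rho). *)
Record elementary_process (rho : Rd -> R) (F : R -> set (set Omega)) :=
  ElementaryProcess {
  ep_size : nat ;
  ep_left : 'I_ep_size -> R ;
  ep_right : 'I_ep_size -> R ;
  ep_event : 'I_ep_size -> set Omega ;
  ep_val : 'I_ep_size -> Rd -> R ;
  ep_le : forall i, 0 <= ep_left i <= ep_right i ;
  ep_adapted : forall i, F (ep_left i) (ep_event i) ;
  ep_L2 : forall i, L2 rho (ep_val i) }.

Definition elementary_fun rho F (Phi : elementary_process rho F)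
    (s : R) (w : Omega) (x : Rd) : R :=
  \sum_(i < ep_size Phi)
    \1_(`]ep_left i, ep_right i]) s * \1_(ep_event i) w * ep_val i x.

Definition elementary_int rho F (Phi : elementary_process rho F)
    (b : R -> Omega -> R) (T : R) (w : Omega) (x : Rd) : R :=
  \sum_(i < ep_size Phi) \1_(ep_event i) w *
    (b (Num.min (ep_right i) T) w - b (Num.min (ep_left i) T) w) * ep_val i x.

(* Ito integral over [0, T] of an L^2(rho)-valued process: the integrand is
   approximated by elementary processes in L^2([0, T] x Omega; L^2(rho)), their
   integrals converge to I in L^2(Omega; L^2(rho)). *)
Definition is_ito_integral (rho : Rd -> R) (F : R -> set (set Omega))
    (b : R -> Omega -> R) (T : R) (phi : R -> Omega -> Rd -> R)
    (I : Omega -> Rd -> R) : Prop :=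
  [/\ forall s w, 0 <= s <= T -> L2 rho (phi s w), forall w, L2 rho (I w)
    & exists Phi : nat -> elementary_process rho F,
    ((fun n => upint (lebesgue_measure \x P)%E (`[0, T] `*` setT)
        (fun sw => sqnormL2 rho
          (elementary_fun (Phi n) sw.1 sw.2 \- phi sw.1 sw.2)))
      @ \oo --> 0%E) /\
    ((fun n => upint P setT
        (fun w => sqnormL2 rho (elementary_int (Phi n) b T w \- I w)))
      @ \oo --> 0%E)].

(* In the stochastic convolution only the indices with a_k > 0 carry an
   integral: W says nothing about beta_k when a_k = 0, which need not even be
   adapted. *)
Definition is_stochastic_convolution (rho : Rd -> R)
    (F : R -> set (set Omega)) (a : nat -> R) (b : nat -> R -> Omega -> R)
    (e : nat -> Rd -> R) (t : R) (psi : R -> Omega -> Rd -> R)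
    (Z : Omega -> Rd -> R) : Prop :=
  (forall w, L2 rho (Z w)) /\
  exists I : nat -> Omega -> Rd -> R,
    (forall k, 0 < a k -> is_ito_integral rho F (b k) t
      (fun s w => heat_semigroup (t - s) (fun y => psi s w y * e k y)) (I k)) /\
    ((fun n => upint P setT (fun w => sqnormL2 rho
        (fun x => \sum_(k < n) Num.sqrt (a k) * I k w x - Z w x)))
      @ \oo --> 0%E).

(* The equation holds a.s. as an identity in L^2(rho), for each t. *)
Definition mild_solution (rho : Rd -> R) (F : R -> set (set Omega))
    (a : nat -> R) (b : nat -> R -> Omega -> R) (e : nat -> Rd -> R)
    (f sigma : Rd -> R -> R) (u : R -> Omega -> Rd -> R) : Prop :=
  (forall t, 0 <= t -> L2_random rho (F t) (u t)) /\
  forall t, 0 <= t -> exists D Z : Omega -> Rd -> R,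
    [/\ {ae P, forall w, is_bochner_integral rho t
          (fun s => heat_semigroup (t - s) (fun y => f y (u s w y))) (D w)},
        is_stochastic_convolution rho F a b e t
          (fun s w y => sigma y (u s w y)) Z
      & {ae P, forall w, sqnormL2 rho (fun x =>
          u t w x - (heat_semigroup t (u 0 w) x + D w x + Z w x)) = 0%E}].

End stochastic.

(* Main.v *)
Require Import Defs.
From HB Require Import structures.
From mathcomp Require Import all_boot all_order all_algebra.
From mathcomp Require Import all_classical all_reals all_analysis.
From mathcomp Require Import measurable_realfun.
From mathcomp Require Import ess_sup_inf ring lra.

Set Implicit Arguments.
Unset Strict Implicit.
Unset Printing Implicit Defensive.
Import Order.TTheory GRing.Theory Num.Theory.
Import numFieldNormedType.Exports.

Local Open Scope classical_set_scope.
Local Open Scope ring_scope.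

(** The mild formulation writes u(t) = S(t)u(0) + D(t) + Z(t), with D the drift
    and Z the stochastic convolution. Each term is bounded in L^2(Omega; H)
    uniformly in t.

    Free evolution. For t > 0 the heat kernel is a probability density, so
    Jensen's inequality gives (S(t)v)^2 <= S(t)(v^2), and integrating in space
    with Tonelli makes S(t) a contraction of L^2(R^d)
    ([sqnormL2_heat_contraction]). Since rho is bounded, ||S(t)u(0)||_H is at
    most a multiple of ||u(0)||_(L^2(R^d)).

    Dispersion. The kernel G(t) also has supremum (4 pi t)^(-d/2). If psi >= 0
    is bounded by M both in L^1 and in L^oo, then S(t)psi is bounded by M times
    [heat_decay t], which decays like t^(-3/2) because d >= 3
    ([heat_conv_decay]). The time integral of this rate over [0, t] is bounded
    uniformly in t ([integral_heat_decay]).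

    Drift. |S(t - s)f(., u(s))| <= S(t - s)phi, so the dispersive estimate
    bounds the H-norm of the integrand by an integrable function of t - s, and
    Minkowski's inequality for Bochner integrals ([bochner_integral_le]) gives
    a deterministic bound on D.

    Stochastic convolution. By Jensen,
    (S(t - s)[sigma(., u(s)) e_k])^2 <= sigma0^2 S(t - s)(e_k^2), and e_k^2 is
    bounded by 1 in L^1 (normalization) and in L^oo (by assumption), so the same
    rate appears for the square. Ito's isometry and a = sum a_k < oo then bound
    E||Z(t)||_H^2. The triangle inequality would require sum sqrt(a_k) < oo, so
    the isometry has to be proved jointly for all the Brownian motions, with
    orthogonality of the contributions of distinct beta_k
    ([ito_isometry_sum]). Its ingredients are the covariances
    E[1_A (beta_k(t) - beta_k(s)) (beta_j(t) - beta_j(s))] for A in F_s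
    ([inc_covariance_past]) and the orthogonality of successive increments
    ([inc_orthogonal]). The filtration knows the beta_k through W alone: when
    a_k > 0, beta_k = <W, e_k> / sqrt(a_k) almost surely ([beta_noise]), so
    increments of beta_k are linear functionals of increments of W, and
    polarization reduces products of increments to squares of such functionals.

    Measurability. Convergence in mean is expressed with upper integrals, which
    yield measurable majorants ([upint_near_majorant]), whereas the integral of
    a nonnegative function is a supremum over simple functions below it, that
    is, a lower integral. The estimates of the three terms are combined through
    [lower_integral_le], which mixes both: the majorants of D and Z are
    measurable, and E||u(0)||^2 enters as a lower integral. *)

(** * Lower integrals and measurable majorants *)

Section lower_upper_integral.
Context d (T : measurableType d) (R : realType).
Variable mu : {measure set T -> \bar R}.
Implicit Types (D : set T) (f g h k : T -> \bar R).
Local Open Scope ereal_scope.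
Import HBNNSimple.

(** The integral of a nonnegative function is a supremum over the simple
    functions below it, hence is monotone on all nonnegative functions. *)
Lemma le_lower_integral D f g : (forall x, D x -> 0 <= f x) ->
  (forall x, D x -> f x <= g x) ->
  \int[mu]_(x in D) f x <= \int[mu]_(x in D) g x.
Proof.
move=> f0 fg.
have g0 x : D x -> 0 <= g x by move=> Dx; exact: le_trans (f0 _ Dx) (fg _ Dx).
rewrite (ge0_integralE mu f0) (ge0_integralE mu g0).
apply: ge_ereal_sup => _ [s /= sf <-]; apply: ereal_sup_ubound.
exists s => //= x; apply: le_trans (sf x) _; rewrite !patchE.
by case: ifPn => // /set_mem; exact: fg.
Qed.

(** Lower integrals are not subadditive, but here h is measurable: from a simple
    function s <= f one can subtract h and stay measurable, and what remains lies
    below M k. *)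
Lemma lower_integral_le f k h (M : R) : (0 < M)%R ->
  (forall x, 0 <= f x) -> (forall x, 0 <= k x) -> (forall x, 0 <= h x) ->
  measurable_fun setT h -> {ae mu, forall x, f x <= M%:E * k x + h x} ->
  \int[mu]_x f x <= M%:E * \int[mu]_x k x + \int[mu]_x h x.
Proof.
move=> M0 f0 k0 h0 mh [N [mN N0 fN]].
rewrite (ge0_integralTE mu f0); apply: ge_ereal_sup => _ [s /= sf <-].
pose g := (fun x => maxe ((s x)%:E - h x) 0) \_ (~` N).
have mg : measurable_fun setT g.
  apply/(measurable_restrictT _ (measurableC mN)).1; apply: measurable_funTS.
  apply: measurable_maxe => //; apply: emeasurable_funB => //.
  by apply/measurable_EFinP.
have g0 x : 0 <= g x.
  by rewrite /g patchE; case: ifPn => // _; rewrite le_max lexx orbT.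
have gk x : g x <= M%:E * k x.
  rewrite /g patchE in_setC; case: ifPn => [xN|_]; last first.
    by rewrite mule_ge0// lee_fin ltW.
  have fx : f x <= M%:E * k x + h x.
    by apply: contrapT => nfx; move/negP: xN; apply; rewrite inE; exact: fN.
  rewrite ge_max; apply/andP; split; last by rewrite mule_ge0// lee_fin ltW.
  case: (h x) (h0 x) fx => [r|//|//] _ fx; last by rewrite leNye.
  by rewrite leeBlDr//; apply: le_trans (sf x) fx.
(* The exceptional null set is absorbed by a function that is infinite on it. *)
pose b : T -> \bar R := cst +oo \_ N.
have mb : measurable_fun setT b by exact/(measurable_restrictT _ mN).1.
have b0 x : 0 <= b x by rewrite /b patchE; case: ifP => //= _; rewrite leey.
have -> : \int[mu]_x h x = \int[mu]_x (h x + b x).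
  apply: ge0_ae_eq_integral => //.
  - exact: emeasurable_funD.
  - by move=> x _; rewrite adde_ge0.
  - exists N; split => // x /= /not_implyP[_ /eqP hb].
    apply: contrapT => xN; move: hb; rewrite /b patchE memNset//.
    by rewrite adde0 eqxx.
have -> : sintegral mu s = \int[mu]_x (s x)%:E by rewrite integralT_nnsfun.
have sg x : (s x)%:E <= g x + (h x + b x).
  rewrite /g /b !patchE in_setC; case: (boolP (x \in N)) => _ /=.
    by rewrite add0e addeC addye ?leey// gt_eqF// (lt_le_trans _ (h0 x)).
  rewrite adde0; case: (h x) (h0 x) => [r|//|//] _.
    by rewrite -leeBlDr// le_max lexx.
  by rewrite addeC addye ?leey// gt_eqF// (@lt_le_trans _ _ 0)// le_max lexx orbT.
apply: (@le_trans _ _ (\int[mu]_x (g x + (h x + b x)))).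
  by apply: le_lower_integral => // x _; exact: fun_ge0.
have hb0 x : 0 <= h x + b x by rewrite adde_ge0.
have mhb : measurable_fun setT (fun x => h x + b x) by exact: emeasurable_funD.
rewrite [leLHS]ge0_integralD//; apply: leeD => //.
have -> : \int[mu]_x g x = M%:E * \int[mu]_x (M^-1%:E * g x).
  rewrite ge0_integralZl_EFin// ?muleA; last by rewrite invr_ge0 ltW.
  by rewrite -EFinM divff ?gt_eqF// mul1e.
apply: lee_wpmul2l; first by rewrite lee_fin ltW.
apply: le_lower_integral => x _; first by rewrite mule_ge0// lee_fin invr_ge0 ltW.
have -> : k x = M^-1%:E * (M%:E * k x).
  by rewrite muleA -EFinM mulVf ?gt_eqF// mul1e.
by apply: lee_wpmul2l => //; rewrite lee_fin invr_ge0 ltW.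
Qed.

(** The infimum that defines the upper integral runs over measurable majorants. *)
Lemma upint_near_majorant D (f_ : nat -> T -> \bar R) (eps : R) :
  (fun n => upint mu D (f_ n)) @ \oo --> 0 -> (0 < eps)%R ->
  \forall n \near \oo, exists h, [/\ measurable_fun D h,
    forall x, D x -> f_ n x <= h x & \int[mu]_(x in D) h x < eps%:E].
Proof.
move=> f0 eps0.
have /f0 : nbhs (0 : \bar R) [set y | y < eps%:E].
  by have := @open_ereal_lt' R 0 eps%:E; rewrite lte_fin => /(_ eps0).
move=> f0e; near=> n.
have : upint mu D (f_ n) < eps%:E by near: n; exact: f0e.
by case/ereal_inf_lt => _ [h [mh fh] <-] he; exists h.
Unshelve. all: by end_near. Qed.

End lower_upper_integral.

(** * The inner product of the weighted space *)

Lemma discriminant_le (R : realFieldType) (A B C : R) : 0 <= A -> 0 <= C ->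
  (forall a b, 0 <= a ^+ 2 * A + 2 * (a * b) * B + b ^+ 2 * C) ->
  B ^+ 2 <= A * C.
Proof.
rewrite le_eqVlt => /orP[/eqP A0|A0]; last first.
  move=> _ /(_ B (- A)) h.
  have : 0 <= A * (A * C - B ^+ 2) by move: h; congr (_ <= _); ring.
  by rewrite pmulr_rge0// subr_ge0.
rewrite le_eqVlt => /orP[/eqP C0|C0].
  by move=> /(_ 1 (- B)); rewrite -A0 -C0; lra.
move=> /(_ (- C) B) h.
have : 0 <= C * (A * C - B ^+ 2) by move: h; congr (_ <= _); ring.
by rewrite pmulr_rge0// subr_ge0.
Qed.

Section weighted_inner_product.
Context {R : realType} {d : nat}.
Local Notation Rd := 'rV[R]_d.
Local Notation leb := (lebesgue_rV d).
Variable rho : Rd -> R.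
Hypothesis mrho : measurable_fun setT rho.
Hypothesis rho0 : forall x, 0 <= rho x.
Implicit Types u v w : Rd -> R.

Definition ipL2 u v : R := \int[leb]_x (u x * v x * rho x).

Lemma sqnormL2_ge0 w : (0 <= sqnormL2 rho w)%E.
Proof. by apply: integral_ge0 => x _; rewrite lee_fin mulr_ge0// sqr_ge0. Qed.

Lemma measurable_sq_rho w : measurable_fun setT w ->
  measurable_fun setT (fun x => (w x ^+ 2 * rho x)%:E).
Proof.
move=> mw; apply/measurable_EFinP; apply: measurable_funM => //.
exact: measurable_funX.
Qed.

Lemma integrable_ip u v : L2 rho u -> L2 rho v ->
  leb.-integrable setT (fun x => (u x * v x * rho x)%:E).
Proof.
move=> [mu uoo] [mv voo].
have iu : leb.-integrable setT (fun x => (u x ^+ 2 * rho x)%:E).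
  apply/integrableP; split; first exact: measurable_sq_rho.
  apply: le_lt_trans uoo; apply: le_lower_integral => x _; first exact: abse_ge0.
  by rewrite gee0_abs// lee_fin mulr_ge0// sqr_ge0.
have iv : leb.-integrable setT (fun x => (v x ^+ 2 * rho x)%:E).
  apply/integrableP; split; first exact: measurable_sq_rho.
  apply: le_lt_trans voo; apply: le_lower_integral => x _; first exact: abse_ge0.
  by rewrite gee0_abs// lee_fin mulr_ge0// sqr_ge0.
apply: le_integrable (integrableD measurableT iu iv) => //.
  apply/measurable_EFinP; apply: measurable_funM => //.
  exact: measurable_funM.
move=> x _ /=; rewrite lee_fin -mulrDl normrM (ger0_norm (rho0 x)).
rewrite [leRHS]ger0_norm; last by rewrite mulr_ge0// addr_ge0// sqr_ge0.
rewrite ler_wpM2r// ler_norml.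
by have := sqr_ge0 (u x + v x); have := sqr_ge0 (u x - v x);
  have := sqr_ge0 (u x); have := sqr_ge0 (v x); nra.
Qed.

Lemma sqnormL2E w : L2 rho w -> sqnormL2 rho w = (ipL2 w w)%:E.
Proof.
move=> Lw; rewrite /ipL2 /Rintegral fineK; last first.
  exact: integrable_fin_num (integrable_ip Lw Lw).
by apply: eq_integral => x _; rewrite expr2.
Qed.

Lemma sqnormL2D u v : measurable_fun setT u -> measurable_fun setT v ->
  (sqnormL2 rho (u \+ v)%R <= 2%:E * sqnormL2 rho u + 2%:E * sqnormL2 rho v)%E.
Proof.
move=> mu mv; rewrite /sqnormL2.
have h0 w x : (0 <= (w x ^+ 2 * rho x)%:E)%E.
  by rewrite lee_fin mulr_ge0// sqr_ge0.
rewrite -!ge0_integralZl_EFin//; [|exact: measurable_sq_rho..].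
rewrite -ge0_integralD//; last 4 first.
- by move=> x _; rewrite mule_ge0.
- by apply: emeasurable_funM => //; exact: measurable_sq_rho.
- by move=> x _; rewrite mule_ge0.
- by apply: emeasurable_funM => //; exact: measurable_sq_rho.
apply: le_lower_integral => // x _.
rewrite -!EFinM -EFinD lee_fin !mulrA -mulrDl ler_wpM2r//= .
by have := sqr_ge0 (u x - v x); nra.
Qed.

Lemma sqnormL2Z c w : measurable_fun setT w ->
  sqnormL2 rho (fun x => c * w x) = ((c ^+ 2)%:E * sqnormL2 rho w)%E.
Proof.
move=> mw; rewrite /sqnormL2 -ge0_integralZl_EFin ?sqr_ge0//; last 2 first.
- by move=> x _; rewrite lee_fin mulr_ge0// sqr_ge0.
- exact: measurable_sq_rho.
by apply: eq_integral => x _; rewrite -EFinM exprMn -mulrA.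
Qed.

Lemma L2D u v : L2 rho u -> L2 rho v -> L2 rho (u \+ v).
Proof.
move=> [mu uoo] [mv voo]; split; first exact: measurable_funD.
apply: le_lt_trans (sqnormL2D mu mv) _.
by rewrite lte_add_pinfty// lte_mul_pinfty.
Qed.

Lemma L2Z c u : L2 rho u -> L2 rho (fun x => c * u x).
Proof.
move=> [mu uoo]; split; first exact: measurable_funM.
by rewrite sqnormL2Z// lte_mul_pinfty// lee_fin sqr_ge0.
Qed.

Lemma L2B u v : L2 rho u -> L2 rho v -> L2 rho (u \- v).
Proof.
move=> Lu Lv; rewrite (_ : u \- v = u \+ (fun x => -1 * v x)).
  by apply: L2D => //; exact: L2Z.
by apply/funext => x /=; rewrite mulN1r.
Qed.

Lemma L2_cst0 : L2 rho (cst 0).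
Proof.
split; first exact: measurable_cst.
rewrite /sqnormL2 integral0_eq// => x _.
by rewrite /= expr0n mul0r.
Qed.

Lemma L2_sum I (s : seq I) (c : I -> R) (u : I -> Rd -> R) :
  (forall i, L2 rho (u i)) -> L2 rho (fun x => \sum_(i <- s) c i * u i x).
Proof.
move=> Lu; elim: s => [|i s IH].
  rewrite (_ : (fun _ => _) = cst 0); first exact: L2_cst0.
  by apply/funext => x; rewrite big_nil.
rewrite (_ : (fun _ => _) =
    (fun x => c i * u i x) \+ (fun x => \sum_(j <- s) c j * u j x)).
  by apply: L2D => //; exact: L2Z.
by apply/funext => x; rewrite big_cons.
Qed.

Lemma ipC u v : ipL2 u v = ipL2 v u.
Proof. by apply: eq_Rintegral => x _; rewrite (mulrC (u x)). Qed.

Lemma ipDl u v w : L2 rho u -> L2 rho v -> L2 rho w ->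
  ipL2 (u \+ v) w = ipL2 u w + ipL2 v w.
Proof.
move=> Lu Lv Lw; rewrite /ipL2 -RintegralD//; [|exact: integrable_ip..].
by apply: eq_Rintegral => x _; rewrite /= !mulrDl.
Qed.

Lemma ipZl c u w : L2 rho u -> L2 rho w ->
  ipL2 (fun x => c * u x) w = c * ipL2 u w.
Proof.
move=> Lu Lw; rewrite /ipL2 -RintegralZl//; last exact: integrable_ip.
by apply: eq_Rintegral => x _; rewrite !mulrA.
Qed.

Lemma ipBl u v w : L2 rho u -> L2 rho v -> L2 rho w ->
  ipL2 (u \- v) w = ipL2 u w - ipL2 v w.
Proof.
move=> Lu Lv Lw; rewrite (_ : u \- v = u \+ (fun x => -1 * v x)); last first.
  by apply/funext => x /=; rewrite mulN1r.
by rewrite ipDl ?ipZl ?mulN1r//; exact: L2Z.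
Qed.

Lemma ip_suml I (s : seq I) (c : I -> R) (u : I -> Rd -> R) w :
  (forall i, L2 rho (u i)) -> L2 rho w ->
  ipL2 (fun x => \sum_(i <- s) c i * u i x) w =
  \sum_(i <- s) c i * ipL2 (u i) w.
Proof.
move=> Lu Lw; elim: s => [|i s IH].
  rewrite big_nil /ipL2 (_ : (fun _ => _) = cst 0); last first.
    by apply/funext => x; rewrite big_nil !mul0r.
  by rewrite /Rintegral integral0_eq.
rewrite big_cons -IH -ipZl// -ipDl//; last 2 first.
- exact: L2Z.
- exact: L2_sum.
by apply: eq_Rintegral => x _; rewrite big_cons.
Qed.

Lemma ip_ge0 u : 0 <= ipL2 u u.
Proof.
by apply: Rintegral_ge0 => x _; rewrite mulr_ge0// -expr2 sqr_ge0.
Qed.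

Lemma ip_CS u v : L2 rho u -> L2 rho v ->
  ipL2 u v ^+ 2 <= ipL2 u u * ipL2 v v.
Proof.
move=> Lu Lv.
have key (a b : R) : 0 <= a ^+ 2 * ipL2 u u + 2 * (a * b) * ipL2 u v
    + b ^+ 2 * ipL2 v v.
  have La := L2Z a Lu; have Lb := L2Z b Lv; have Lab := L2D La Lb.
  have := ip_ge0 ((fun x => a * u x) \+ (fun x => b * v x)).
  rewrite ipDl// ![ipL2 _ (_ \+ _)]ipC !ipDl//.
  rewrite ipZl// ![ipL2 _ (fun _ => a * _)]ipC !ipZl//.
  rewrite ![ipL2 _ (fun _ => b * _)]ipC !ipZl// (ipC v u).
  by congr (_ <= _); ring.
exact: discriminant_le (ip_ge0 u) (ip_ge0 v) key.
Qed.

End weighted_inner_product.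

(** * The heat kernel as a product of Gaussian densities *)

Section product_integral.
Context {R : realType}.
Local Open Scope ereal_scope.

Lemma integral_consv n (f : 'rV[R]_n.+1 -> \bar R) :
  measurable_fun setT f -> (forall x, 0 <= f x) ->
  \int[lebesgue_rV n.+1]_x f x =
  \int[lebesgue_measure]_a \int[lebesgue_rV n]_v f (consv (a, v)).
Proof.
move=> mf f0.
have mfc : measurable_fun setT (f \o @consv R n).
  exact: (measurableT_comp mf (@measurable_consv R n)).
rewrite -(@fubini_tonelli1 _ _ _ _ _ lebesgue_measure (lebesgue_rV n)
  (f \o @consv R n))//.
transitivity (\int[pushforward (@lebesgue_measure R \x lebesgue_rV n)
    (@consv R n)]_x f x); first by [].
- have mc : measurable_fun setT
    (@consv R n : (measurableTypeR R * 'rV[R]_n)%type -> _) := @measurable_consv R n.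
  by have := @ge0_integral_pushforward _ _ _ _ R _ mc
    (@lebesgue_measure R \x lebesgue_rV n)%E _ _ measurableT mf (fun y _ => f0 y).
by move=> x; exact: f0.
Qed.

Lemma integral_rV_prod n (g : 'I_n -> R -> R) :
  (forall i, measurable_fun setT (g i)) -> (forall i x, (0 <= g i x)%R) ->
  (forall i, \int[lebesgue_measure]_x (g i x)%:E = 1) ->
  \int[lebesgue_rV n]_x (\prod_(i < n) g i (x ord0 i))%:E = 1.
Proof.
elim: n g => [|n IH] g mg g0 g1.
  under eq_integral do rewrite big_ord0.
  by rewrite integral_dirac ?diracT ?mul1e.
have mprod m (h : 'I_m -> R -> R) : (forall i, measurable_fun setT (h i)) ->
    measurable_fun setT (fun x : 'rV[R]_m => \prod_(i < m) h i (x ord0 i))%R.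
  move=> mh; apply: measurable_prod => i _.
  exact: (measurableT_comp (mh i) (measurable_coor i)).
rewrite integral_consv; last 2 first.
- by apply/measurable_EFinP; exact: mprod.
- by move=> x; rewrite lee_fin prodr_ge0.
rewrite -[RHS](g1 ord0); apply: eq_integral => a _.
transitivity (\int[lebesgue_rV n]_v ((g ord0 a)%:E *
    (\prod_(i < n) g (lift ord0 i) (v ord0 i))%:E)).
  apply: eq_integral => v _; rewrite big_ord_recl mxE unlift_none EFinM.
  by congr (_ * _%:E); apply: eq_bigr => i _; rewrite mxE liftK.
rewrite ge0_integralZl_EFin//; last 2 first.
- by move=> v _; rewrite lee_fin prodr_ge0.
- by apply/measurable_EFinP; apply: (mprod n (fun i => g (lift ord0 i))).
by rewrite (IH (fun i => g (lift ord0 i))) ?mule1.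
Qed.

End product_integral.

Section heat_kernel_bounds.
Context {R : realType} {d : nat}.
Local Notation Rd := 'rV[R]_d.
Local Notation leb := (lebesgue_rV d).

Lemma heat_kernel_ge0 (t : R) (z : Rd) : 0 <= heat_kernel t z.
Proof. by rewrite /heat_kernel mulr_ge0 ?powR_ge0 ?expR_ge0. Qed.

Lemma heat_kernel_le (t : R) (z : Rd) : 0 < t ->
  heat_kernel t z <= (4 * pi * t) `^ (- (d%:R / 2)).
Proof.
move=> t0; rewrite /heat_kernel ler_piMr ?powR_ge0//.
rewrite -[leRHS]expR0 ler_expR mulNr oppr_le0 mulr_ge0//.
  by apply: sumr_ge0 => i _; rewrite sqr_ge0.
by rewrite invr_ge0 mulr_ge0// ltW.
Qed.

Lemma heat_kernelC (t : R) (x y : Rd) :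
  heat_kernel t (x - y) = heat_kernel t (y - x).
Proof.
have sqC : \sum_i (x - y) ord0 i ^+ 2 = \sum_i (y - x) ord0 i ^+ 2.
  by apply: eq_bigr => i _; rewrite !mxE -sqrrN opprB.
by rewrite /heat_kernel sqC.
Qed.

Lemma measurable_heat_kernel (t : R) :
  measurable_fun setT (fun p : Rd * Rd => heat_kernel t (p.1 - p.2)).
Proof.
rewrite /heat_kernel; apply: measurable_funM => //.
apply: measurableT_comp; first exact: measurable_expR.
apply: measurable_funM => //; apply: measurableT_comp => //.
apply: measurable_sum => i; apply: measurable_funX.
rewrite (_ : (fun _ => _) = (fun p : Rd * Rd => coor i p.1 - coor i p.2)).
  apply: measurable_funB.
    exact: (measurableT_comp (measurable_coor i) measurable_fst).
  exact: (measurableT_comp (measurable_coor i) measurable_snd).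
by apply/funext => p; rewrite /coor !mxE.
Qed.

(** The variance 2t in each coordinate turns the heat kernel into a product of
    one-dimensional normal densities; its mass is then computed by Tonelli. *)
Lemma heat_kernel_prod (t : R) (x y : Rd) : 0 < t ->
  heat_kernel t (x - y) =
  \prod_(i < d) normal_pdf (x ord0 i) (Num.sqrt (2 * t)) (y ord0 i).
Proof.
move=> t0.
have s0 : Num.sqrt (2 * t) != 0 by rewrite gt_eqF// sqrtr_gt0 mulr_gt0.
have s2 : Num.sqrt (2 * t) ^+ 2 = 2 * t by rewrite sqr_sqrtr// mulr_ge0// ltW.
under eq_bigr do rewrite normal_pdfE//.
rewrite big_split/= prodr_const card_ord; congr (_ * _).
  rewrite /normal_peak s2.
  have -> : 2 * t * pi *+ 2 = 4 * pi * t by rewrite mulr2n; ring.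
  have pt0 : 0 <= 4 * pi * t by rewrite !mulr_ge0 ?pi_ge0// ltW.
  rewrite -powR12_sqrt// -powRN -powR_mulrn ?powR_ge0// -powRrM.
  by congr (_ `^ _); rewrite mulNr mulrC.
rewrite /normal_fun s2 -expR_sum; congr expR.
rewrite -mulr_suml sumrN; congr (- _ / _); last by rewrite mulr2n; ring.
by apply: eq_bigr => i _; rewrite !mxE -sqrrN opprB.
Qed.

Lemma integral_heat_kernel (t : R) (x : Rd) : 0 < t ->
  (\int[leb]_y (heat_kernel t (x - y))%:E = 1)%E.
Proof.
move=> t0; under eq_integral do rewrite heat_kernel_prod//.
rewrite (integral_rV_prod (g := fun i => normal_pdf (x ord0 i) _))//.
- by move=> i; exact: measurable_normal_pdf.
- by move=> i y; exact: normal_pdf_ge0.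
- by move=> i; exact: integral_normal_pdf.
Qed.

End heat_kernel_bounds.

(** * Contraction and decay of the heat semigroup *)

Section heat_semigroup_bounds.
Context {R : realType} {d : nat}.
Local Notation Rd := 'rV[R]_d.
Local Notation leb := (lebesgue_rV d).
Implicit Types (v psi rho : Rd -> R) (t M Q : R).

Definition heat_conv t psi (x : Rd) : \bar R :=
  (\int[leb]_y (heat_kernel t (x - y) * psi y)%:E)%E.

Lemma measurable_heat_kernel_section t (x : Rd) :
  measurable_fun setT (fun y : Rd => heat_kernel t (x - y)).
Proof.
exact: (measurableT_comp (@measurable_heat_kernel R d t) (measurable_pair1 x)).
Qed.

Lemma measurable_heat_integrand t psi : measurable_fun setT psi ->
  measurable_fun setT
    (fun p : Rd * Rd => (heat_kernel t (p.1 - p.2) * psi p.2)%:E).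
Proof.
move=> mpsi; apply/measurable_EFinP; apply: measurable_funM.
  exact: measurable_heat_kernel.
exact: (measurableT_comp mpsi measurable_snd).
Qed.

(** Jensen's inequality, obtained as Cauchy-Schwarz between v and 1 in L^2 of
    the probability measure G(t, x - y)dy. *)
Lemma heat_sq_le t v x : 0 < t -> measurable_fun setT v ->
  ((heat_semigroup t v x ^+ 2)%:E <= heat_conv t (fun y => (v y ^+ 2)%R) x)%E.
Proof.
move=> t0 mv; set K := fun y => heat_kernel t (x - y).
have mK : measurable_fun setT K by exact: measurable_heat_kernel_section.
have K0 y : 0 <= K y by exact: heat_kernel_ge0.
have convE : heat_conv t (fun y => v y ^+ 2) x = sqnormL2 K v.
  by apply: eq_integral => y _; rewrite mulrC.
rewrite convE; have [voo|] := ltP (sqnormL2 K v) +oo%E; last first.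
  by rewrite leye_eq => /eqP ->; rewrite leey.
have Lv : L2 K v by [].
have K1 : sqnormL2 K (cst 1) = 1%E.
  rewrite -(integral_heat_kernel x t0); apply: eq_integral => y _.
  by rewrite /= expr1n mul1r.
have L1 : L2 K (cst 1) by split; [exact: measurable_cst|rewrite K1 ltry].
rewrite sqnormL2E// lee_fin /heat_semigroup gt_eqF//.
have -> : \int[leb]_y (heat_kernel t (x - y) * v y) = ipL2 K v (cst 1).
  by apply: eq_Rintegral => y _; rewrite /= mulr1 mulrC.
have := ip_CS mK K0 Lv L1; rewrite (_ : ipL2 K (cst 1) (cst 1) = 1) ?mulr1//.
by have := sqnormL2E mK K0 L1; rewrite K1 => -[].
Qed.

Lemma heat_abs_le t v psi x : 0 < t -> measurable_fun setT v ->
  (forall y, `|v y| <= psi y) ->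
  ((`|heat_semigroup t v x|)%:E <= heat_conv t psi x)%E.
Proof.
move=> t0 mv vpsi; rewrite /heat_semigroup gt_eqF//.
have mKv : measurable_fun setT (fun y : Rd => (heat_kernel t (x - y) * v y)%:E).
  apply/measurable_EFinP; apply: measurable_funM => //.
  exact: measurable_heat_kernel_section.
have le_conv : (\int[leb]_y `|(heat_kernel t (x - y) * v y)%:E|
    <= heat_conv t psi x)%E.
  apply: le_lower_integral => y _; first exact: abse_ge0.
  by rewrite lee_fin normrM ger0_norm ?heat_kernel_ge0// ler_wpM2l ?heat_kernel_ge0.
apply: le_trans le_conv; apply: le_trans (le_abse_integral _ _ mKv) => //.
(* If the integral is infinite, its real value is 0 by convention. *)
rewrite /Rintegral; set I := (\int[leb]_y _)%E.
by case: I => [r| |] //=; rewrite normr0// leey.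
Qed.

(** An explicit majorant of min(1, (4 pi t)^(-d/2)) for all d >= 3. The shift
    by 1 leaves it with an elementary primitive, and the factor 4 makes it at
    least 1 on [0, 1], where (1 + t)^(3/2) <= 4. *)
Definition heat_decay t : R := 4 * (1 + t) `^ (- (3 / 2)).

Lemma heat_decay_ge0 t : 0 <= heat_decay t.
Proof. by rewrite mulr_ge0// powR_ge0. Qed.

Lemma heat_decay_ge1 t : 0 <= t <= 1 -> 1 <= heat_decay t.
Proof.
move=> /andP[t0 t1]; rewrite /heat_decay powRN.
have p0 : 0 < (1 + t) `^ (3 / 2) by rewrite powR_gt0; lra.
rewrite ler_pdivlMr// mul1r.
apply: (@le_trans _ _ ((1 + t) `^ 2%:R)); first by rewrite ler_powR; lra.
rewrite powR_mulrn; last by lra.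
nra.
Qed.

Lemma heat_kernel_decay t (z : Rd) : (3 <= d)%N -> 1 <= t ->
  heat_kernel t z <= heat_decay t.
Proof.
move=> d3 t1; apply: le_trans (heat_kernel_le _ _) _; first by lra.
have pit : 1 + t <= 4 * pi * t.
  by have := @pi_ge2 R => pi2; nra.
rewrite !powRN /heat_decay powRN.
have p0 : 0 < (1 + t) `^ (3 / 2) by rewrite powR_gt0; lra.
have le1 : (1 + t) `^ (3 / 2) <= (4 * pi * t) `^ (d%:R / 2).
  apply: (@le_trans _ _ ((4 * pi * t) `^ (3 / 2))).
    by rewrite ge0_ler_powR ?nnegrE//; lra.
  rewrite ler_powR//; first by lra.
  by rewrite ler_pM2r// ?invr_gt0// ler_nat.
apply: (@le_trans _ _ ((1 + t) `^ (3 / 2))^-1).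
  by rewrite lef_pV2// posrE// (lt_le_trans p0).
by rewrite ler_peMl// ?invr_ge0 ?ltW//; lra.
Qed.

(** For t <= 1 the kernel acts as a probability density, so the L^oo bound on
    psi is used; for t >= 1 it acts through its supremum, so the L^1 bound is. *)
Lemma heat_conv_decay t psi M x : (3 <= d)%N -> 0 < t ->
  measurable_fun setT psi -> (forall y, 0 <= psi y) ->
  {ae leb, forall y, psi y <= M} -> (\int[leb]_y (psi y)%:E <= M%:E)%E ->
  0 <= M -> (heat_conv t psi x <= (M * heat_decay t)%:E)%E.
Proof.
move=> d3 t0 mpsi psi0 psiM intM M0.
have mKx := measurable_heat_kernel_section t x.
have [t1|t1] := leP t 1.
  apply: (@le_trans _ _ M%:E); last first.
    by rewrite lee_fin ler_peMr// heat_decay_ge1// t1 ltW.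
  rewrite -[leRHS]mule1 -(integral_heat_kernel x t0) -ge0_integralZl_EFin//.
  - apply: ae_ge0_le_integral => //.
    + by move=> y _; rewrite lee_fin mulr_ge0// heat_kernel_ge0.
    + by apply/measurable_EFinP; exact: measurable_funM.
    + by move=> y _; rewrite lee_fin mulr_ge0// heat_kernel_ge0.
    + by apply/measurable_EFinP; exact: measurable_funM.
    + apply: filterS psiM => y yM _.
      by rewrite lee_fin mulrC ler_wpM2r// heat_kernel_ge0.
  - by move=> y _; rewrite lee_fin heat_kernel_ge0.
  - exact/measurable_EFinP.
apply: (@le_trans _ _ ((heat_decay t)%:E * \int[leb]_y (psi y)%:E)%E).
  rewrite -ge0_integralZl_EFin ?heat_decay_ge0//.
  - apply: le_lower_integral => y _.
      by rewrite lee_fin mulr_ge0// heat_kernel_ge0.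
    by rewrite lee_fin ler_wpM2r// heat_kernel_decay// ltW.
  - by move=> y _; rewrite lee_fin.
  - exact/measurable_EFinP.
rewrite (mulrC M) (EFinM (heat_decay t)); apply: lee_wpmul2l => //.
by rewrite lee_fin heat_decay_ge0.
Qed.

Lemma measurable_heat t v : measurable_fun setT v ->
  measurable_fun setT (heat_semigroup t v).
Proof.
move=> mv; have [->|t0] := eqVneq t 0.
  rewrite (_ : heat_semigroup 0 v = v)//.
  by apply/funext => x; rewrite /heat_semigroup eqxx.
pose f p : \bar R := (heat_kernel t (p.1 - p.2) * v p.2)%:E.
have mf : measurable_fun [set: Rd * Rd] f by exact: measurable_heat_integrand.
rewrite (_ : heat_semigroup t v = fine \o
    (fun x => \int[leb]_y f^\+ (x, y) - \int[leb]_y f^\- (x, y))%E).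
  apply: measurableT_comp => //.
  apply: emeasurable_funB; apply: measurable_fun_fubini_tonelli_F => //.
    exact: measurable_funepos.
  exact: measurable_funeneg.
apply/funext => x; rewrite /heat_semigroup (negbTE t0) /Rintegral /=.
congr fine; rewrite [LHS]integralE; congr (_ - _)%E; apply: eq_integral => y _.
  by rewrite !funeposE.
by rewrite !funenegE.
Qed.

Section weighted.
Variable rho : Rd -> R.
Hypothesis mrho : measurable_fun setT rho.
Hypothesis rho0 : forall x, 0 <= rho x.

Lemma sqnormL2_le_ae v c Q : measurable_fun setT v -> 0 <= c ->
  {ae leb, forall x, v x ^+ 2 <= c} -> (\int[leb]_x (rho x)%:E <= Q%:E)%E ->
  (sqnormL2 rho v <= (c * Q)%:E)%E.
Proof.
move=> mv c0 vc rhoQ; apply: (@le_trans _ _ (c%:E * \int[leb]_x (rho x)%:E)%E).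
  rewrite -ge0_integralZl_EFin//.
  - apply: ae_ge0_le_integral => //.
    + by move=> y _; rewrite lee_fin mulr_ge0// sqr_ge0.
    + exact: measurable_sq_rho.
    + by move=> y _; rewrite lee_fin mulr_ge0.
    + by apply/measurable_EFinP; exact: measurable_funM.
    + by apply: filterS vc => y yM _; rewrite lee_fin ler_wpM2r.
  - by move=> y _; rewrite lee_fin.
  - exact/measurable_EFinP.
by rewrite EFinM; apply: lee_wpmul2l.
Qed.

Lemma sqnormL2_le_cst w c Q : 0 <= c ->
  (forall x, w x ^+ 2 <= c) -> (\int[leb]_x (rho x)%:E <= Q%:E)%E ->
  (sqnormL2 rho w <= (c * Q)%:E)%E.
Proof.
move=> c0 wc rhoQ; apply: (@le_trans _ _ (c%:E * \int[leb]_x (rho x)%:E)%E).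
  rewrite -ge0_integralZl_EFin//.
  - apply: le_lower_integral => x _; first by rewrite lee_fin mulr_ge0// sqr_ge0.
    by rewrite lee_fin ler_wpM2r.
  - by move=> y _; rewrite lee_fin.
  - exact/measurable_EFinP.
by rewrite EFinM; apply: lee_wpmul2l.
Qed.

(** At t = 0, where S(0) = id, pointwise bounds hold only almost everywhere;
    whence the separate case in this lemma and the next two. *)
Lemma sqnormL2_heat_sq t v psi M Q : (3 <= d)%N -> 0 <= t ->
  measurable_fun setT v -> measurable_fun setT psi ->
  (forall y, v y ^+ 2 <= psi y) ->
  {ae leb, forall y, psi y <= M} -> (\int[leb]_y (psi y)%:E <= M%:E)%E ->
  0 <= M -> (\int[leb]_x (rho x)%:E <= Q%:E)%E ->
  (sqnormL2 rho (heat_semigroup t v) <= (M * heat_decay t * Q)%:E)%E.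
Proof.
move=> d3 + mv mpsi vpsi psiM intM M0 rhoQ.
have Md0 s : 0 <= M * heat_decay s by rewrite mulr_ge0// heat_decay_ge0.
rewrite le_eqVlt => /orP[/eqP <-|t0].
  rewrite (_ : heat_semigroup 0 v = v); last first.
    by apply/funext => x; rewrite /heat_semigroup eqxx.
  apply: sqnormL2_le_ae => //; apply: filterS psiM => y yM.
  apply: le_trans (vpsi y) (le_trans yM _).
  by rewrite ler_peMr// heat_decay_ge1// lexx ler01.
apply: sqnormL2_le_cst => // x; rewrite -lee_fin.
apply: le_trans (heat_sq_le x t0 mv) _.
have psi0 y : 0 <= psi y by apply: le_trans (vpsi y); exact: sqr_ge0.
apply: le_trans (heat_conv_decay x d3 t0 mpsi psi0 psiM intM M0).
apply: le_lower_integral => y _.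
  by rewrite lee_fin mulr_ge0 ?heat_kernel_ge0// sqr_ge0.
by rewrite lee_fin ler_wpM2l// heat_kernel_ge0.
Qed.

Lemma sqnormL2_heat_abs t v psi M Q : (3 <= d)%N -> 0 <= t ->
  measurable_fun setT v -> measurable_fun setT psi ->
  (forall y, `|v y| <= psi y) ->
  {ae leb, forall y, psi y <= M} -> (\int[leb]_y (psi y)%:E <= M%:E)%E ->
  0 <= M -> (\int[leb]_x (rho x)%:E <= Q%:E)%E ->
  (sqnormL2 rho (heat_semigroup t v) <= ((M * heat_decay t) ^+ 2 * Q)%:E)%E.
Proof.
move=> d3 + mv mpsi vpsi psiM intM M0 rhoQ.
have Md0 s : 0 <= M * heat_decay s by rewrite mulr_ge0// heat_decay_ge0.
rewrite le_eqVlt => /orP[/eqP <-|t0].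
  rewrite (_ : heat_semigroup 0 v = v); last first.
    by apply/funext => x; rewrite /heat_semigroup eqxx.
  apply: sqnormL2_le_ae => //; first exact: sqr_ge0.
  apply: filterS psiM => y yM; rewrite -real_normK ?num_real//.
  rewrite ler_sqr ?nnegrE//; apply: le_trans (vpsi y) (le_trans yM _).
  by rewrite ler_peMr// heat_decay_ge1// lexx ler01.
apply: sqnormL2_le_cst => [|x|//]; first exact: sqr_ge0.
rewrite -real_normK ?num_real// ler_sqr ?nnegrE// -lee_fin.
apply: le_trans (heat_abs_le x t0 mv vpsi) _.
have psi0 y : 0 <= psi y by apply: le_trans (vpsi y).
exact: heat_conv_decay.
Qed.

(** Jensen followed by Tonelli: the kernel has mass one in the variable x too,
    since it is symmetric. *)
Lemma sqnormL2_heat_contraction t v M : 0 <= t -> measurable_fun setT v ->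
  0 <= M -> {ae leb, forall x, rho x <= M} ->
  (sqnormL2 rho (heat_semigroup t v) <= M%:E * sqnormL2 (cst 1%R) v)%E.
Proof.
move=> t_ge0 mv M0 rhoM.
have [t0|t_neq0] := eqVneq t 0.
  rewrite t0 (_ : heat_semigroup 0 v = v); last first.
    by apply/funext => x; rewrite /heat_semigroup eqxx.
  rewrite /sqnormL2 -ge0_integralZl_EFin//.
  - apply: ae_ge0_le_integral => //.
    + by move=> y _; rewrite lee_fin mulr_ge0// sqr_ge0.
    + exact: measurable_sq_rho.
    + by move=> y _; rewrite lee_fin mulr_ge0// mulr_ge0// sqr_ge0.
    + apply/measurable_EFinP; apply: measurable_funM => //.
      by apply: measurable_funM => //; exact: measurable_funX.
    + apply: filterS rhoM => x xM _.
      by rewrite lee_fin /= mulr1 mulrC ler_wpM2r// sqr_ge0.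
  - by move=> y _; rewrite lee_fin mulr_ge0// sqr_ge0.
  - by apply/measurable_EFinP; apply: measurable_funM => //; exact: measurable_funX.
have t0 : 0 < t by rewrite lt_neqAle eq_sym t_neq0.
have mv2 : measurable_fun setT (fun y => v y ^+ 2) by exact: measurable_funX.
pose f p : \bar R := (heat_kernel t (p.1 - p.2) * v p.2 ^+ 2)%:E.
have mf : measurable_fun [set: Rd * Rd] f.
  exact: (measurable_heat_integrand t mv2).
have f0 p : (0 <= f p)%E.
  by rewrite lee_fin mulr_ge0 ?heat_kernel_ge0// sqr_ge0.
have mconv : measurable_fun setT (heat_conv t (fun y => v y ^+ 2)).
  exact: (@measurable_fun_fubini_tonelli_F _ _ _ _ _ leb f).
have conv0 x : (0 <= heat_conv t (fun y => (v y ^+ 2)%R) x)%E.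
  by apply: integral_ge0 => y _; exact: (f0 (x, y)).
have -> : sqnormL2 (cst 1%R) v = (\int[leb]_x heat_conv t (fun y => (v y ^+ 2)%R) x)%E.
  transitivity (\int[leb]_y \int[leb]_x f (x, y))%E; last first.
    exact: (esym (@fubini_tonelli _ _ _ _ _ leb leb f mf f0)).
  apply: eq_integral => y _.
  transitivity ((v y ^+ 2)%:E * \int[leb]_x (heat_kernel t (y - x))%:E)%E.
    by rewrite integral_heat_kernel// mule1 /= mulr1.
  rewrite -ge0_integralZl_EFin ?sqr_ge0//.
  - by apply: eq_integral => x _; rewrite -EFinM mulrC heat_kernelC.
  - by move=> x _; rewrite lee_fin heat_kernel_ge0.
  - by apply/measurable_EFinP; exact: measurable_heat_kernel_section.
rewrite -ge0_integralZl_EFin//; apply: ae_ge0_le_integral => //.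
- by move=> y _; rewrite lee_fin mulr_ge0// sqr_ge0.
- by apply: measurable_sq_rho => //; exact: measurable_heat.
- by move=> y _; rewrite mule_ge0.
- by apply: emeasurable_funM.
apply: filterS rhoM => x xM _.
apply: (@le_trans _ _ (M%:E * (heat_semigroup t v x ^+ 2)%:E)%E).
  by rewrite lee_fin mulrC ler_wpM2r// sqr_ge0.
by apply: lee_wpmul2l => //; exact: heat_sq_le.
Qed.

End weighted.

End heat_semigroup_bounds.

(** * The decay rate is integrable in time *)

Section decay_integral.
Context {R : realType}.
Local Notation mu := (@lebesgue_measure R).

Lemma is_derive_powR_sub (b p s : R) : s < b ->
  is_derive s 1 (fun s => (b - s) `^ p) (- (p * (b - s) `^ (p - 1))).
Proof.
move=> sb.
have bs0 : 0 < b - s by rewrite subr_gt0.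
have d1 := is_derive1_powR p bs0.
have d2 : is_derive s 1 (fun s : R => b - s) (-1).
  by rewrite -[X in is_derive _ _ _ X]add0r; apply: is_deriveB.
have := @is_derive1_comp R (@powR R ^~ p) (fun s : R => b - s) s _ _ d1 d2.
by rewrite mulrN1.
Qed.

Lemma integral_heat_decay (t : R) : 0 <= t ->
  (\int[mu]_(s in `[0%R, t]) (heat_decay (t - s))%:E <= 8%:E)%E.
Proof.
rewrite le_eqVlt => /orP[/eqP <-|t0].
  by rewrite set_itv1 integral_set1 lee_fin.
(* F is a primitive of the integrand, with values in [0, 8]. *)
pose F (s : R) := 8 * (1 + t - s) `^ (- (1 / 2)).
have dF s : s < 1 + t -> is_derive s 1 F (heat_decay (t - s)).
  move=> st.
  have h := is_derive_powR_sub (- (1 / 2)) st.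
  have := is_deriveZ 8 h.
  rewrite (_ : _ *: _ = heat_decay (t - s))// /heat_decay /= -[LHS]/(_ * _).
  rewrite addrA (_ : - (1 / 2) - 1 = - (3 / 2)); last by lra.
  by rewrite mulNr opprK mulrA; congr (_ * _); lra.
have cF s : s < 1 + t -> {for s, continuous F}.
  move=> st; apply: differentiable_continuous; apply/derivable1_diffP.
  by have [] := dF s st.
have cH s : s < 1 + t -> {for s, continuous (fun s => heat_decay (t - s))}.
  move=> st; apply: differentiable_continuous; apply/derivable1_diffP.
  have [h _] := is_derive_powR_sub (- (3 / 2)) st.
  rewrite (_ : (fun _ => _) = 4 \*: (fun s : R => (1 + t - s) `^ (- (3 / 2)))).
    exact: derivableZ.
  by apply/funext => r; rewrite /heat_decay addrA.
have tt1 : t < 1 + t by lra.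
rewrite (@continuous_FTC2 _ _ F)//.
- rewrite -EFinB lee_fin /F.
  have -> : 1 + t - t = 1 by ring.
  rewrite powR1 mulr1 gerBl mulr_ge0// powR_ge0//.
- apply: continuous_in_subspaceT => s; rewrite inE/= in_itv/= => /andP[_ st].
  by apply: cH; lra.
- split.
  + move=> s; rewrite in_itv/= => /andP[_ st].
    by have [] := dF s (lt_trans st tt1).
  + by apply: cvg_at_right_filter; apply: cF; lra.
  + by apply: cvg_at_left_filter; apply: cF.
- move=> s; rewrite in_itv/= => /andP[_ st].
  by rewrite derive1E; have [_ ->] := dF s (lt_trans st tt1).
Qed.
End decay_integral.

(** * Bochner integrals *)

Section step_functions.
Context d (T : measurableType d) (R : realType).
Variable mu : {measure set T -> \bar R}.
Variable D : set T.
Hypothesis mD : measurable D.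
Hypothesis muD : (mu D < +oo)%E.
Variables (I : Type) (E : I -> set T) (c : I -> R).
Hypothesis mE : forall i, measurable (E i).

Lemma integrable_step (s : seq I) :
  mu.-integrable D (fun x => (\sum_(i <- s) \1_(E i) x * c i)%:E).
Proof.
elim: s => [|i s IH].
  rewrite (_ : (fun _ => _) = cst 0%E); first exact: integrable0.
  by apply/funext => x; rewrite big_nil.
rewrite (_ : (fun _ => _) = (fun x => (c i)%:E * (\1_(E i) x)%:E)%E \+
  (fun x => (\sum_(j <- s) \1_(E j) x * c j)%:E))%E; last first.
  by apply/funext => x; rewrite big_cons EFinD -EFinM mulrC.
apply: integrableD => //; apply: integrableZl => //.
apply/integrableP; split; first by apply/measurable_EFinP; exact: measurable_indic.
under eq_integral do rewrite gee0_abs ?lee_fin//.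
rewrite integral_indic//; apply: le_lt_trans muD.
by apply: le_measure; rewrite ?inE//; exact: measurableI.
Qed.

Lemma integral_step (s : seq I) :
  (\int[mu]_(x in D) (\sum_(i <- s) \1_(E i) x * c i)%:E =
   (\sum_(i <- s) fine (mu (E i `&` D)) * c i)%:E)%E.
Proof.
elim: s => [|i s IH].
  by rewrite big_nil integral0_eq// => x _; rewrite big_nil.
have i1 : mu.-integrable D (fun x => (\1_(E i) x)%:E).
  apply/integrableP; split; first by apply/measurable_EFinP; exact: measurable_indic.
  under eq_integral do rewrite gee0_abs ?lee_fin//.
  rewrite integral_indic//; apply: le_lt_trans muD.
  by apply: le_measure; rewrite ?inE//; exact: measurableI.
under eq_integral do rewrite big_cons EFinD mulrC EFinM.
rewrite integralD//; last 2 first.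
- exact: integrableZl.
- exact: integrable_step.
rewrite integralZl// IH integral_indic// big_cons EFinD mulrC EFinM fineK//.
rewrite ge0_fin_numE//; apply: le_lt_trans muD.
by apply: le_measure; rewrite ?inE//; exact: measurableI.
Qed.

End step_functions.

Section bochner_bound.
Context {R : realType} {d : nat}.
Local Notation Rd := 'rV[R]_d.
Local Notation leb := (lebesgue_rV d).
Variable rho : Rd -> R.
Hypothesis mrho : measurable_fun setT rho.
Hypothesis rho0 : forall x, 0 <= rho x.

Lemma normL2E u : L2 rho u -> normL2 rho u = (Num.sqrt (ipL2 rho u u))%:E.
Proof.
move=> Lu; rewrite /normL2 sqnormL2E// poweR_EFin powR12_sqrt//.
exact: ip_ge0.
Qed.

Lemma ip_le_norm u v : L2 rho u -> L2 rho v ->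
  `|ipL2 rho u v| <= Num.sqrt (ipL2 rho u u) * Num.sqrt (ipL2 rho v v).
Proof.
move=> Lu Lv; rewrite -sqrtrM ?ip_ge0// -sqrtr_sqr ler_wsqrtr//.
exact: ip_CS.
Qed.

Lemma sqrt_ipD u v : L2 rho u -> L2 rho v ->
  Num.sqrt (ipL2 rho (u \+ v) (u \+ v)) <=
  Num.sqrt (ipL2 rho u u) + Num.sqrt (ipL2 rho v v).
Proof.
move=> Lu Lv; have Luv := L2D mrho rho0 Lu Lv.
rewrite -ler_sqr ?nnegrE ?addr_ge0 ?sqrtr_ge0// sqr_sqrtr ?ip_ge0//.
rewrite ipDl// ![ipL2 rho _ (u \+ v)]ipC !ipDl// (ipC rho v u).
have := ip_le_norm Lu Lv; rewrite ler_norml => /andP[_ uv].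
rewrite sqrrD !sqr_sqrtr ?ip_ge0//.
by move: uv; set a := Num.sqrt _ * _; lra.
Qed.

Lemma L2_simple_map (g : simple_map rho) s : L2 rho (simple_map_fun g s).
Proof. by apply: L2_sum => // i; exact: sm_L2. Qed.

Lemma L2_simple_map_int (g : simple_map rho) t : L2 rho (simple_map_int g t).
Proof. by apply: L2_sum => // i; exact: sm_L2. Qed.

(** Minkowski's inequality for integrals, by duality: testing the integral v
    of a step map against v itself turns it into a scalar integral. *)
Lemma simple_map_int_le (g : simple_map rho) (t B : R) (h : R -> \bar R) :
  0 <= B -> measurable_fun `[0, t] h ->
  (forall s, 0 <= s <= t -> (normL2 rho (simple_map_fun g s) <= h s)%E) ->
  (\int[lebesgue_measure]_(s in `[0%R, t]) h s <= B%:E)%E ->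
  (sqnormL2 rho (simple_map_int g t) <= (B ^+ 2)%:E)%E.
Proof.
move=> B0 mh gh hB; set v := simple_map_int g t.
have Lv : L2 rho v by exact: L2_simple_map_int.
set N := Num.sqrt (ipL2 rho v v).
have N0 : 0 <= N by exact: sqrtr_ge0.
have N2 : ipL2 rho v v = N ^+ 2 by rewrite sqr_sqrtr// ip_ge0.
have toof : (lebesgue_measure `[0%R, t]%classic < +oo :> \bar R)%E.
  by rewrite lebesgue_measure_itv/=; case: ifP => // _; rewrite -EFinB ltry.
have vvE : (ipL2 rho v v)%:E =
    (\int[lebesgue_measure]_(s in `[0%R, t])
      (ipL2 rho (simple_map_fun g s) v)%:E)%E.
  rewrite {1}/v /simple_map_int ip_suml//; last by move=> i; exact: sm_L2.
  rewrite -(@integral_step _ _ R (@lebesgue_measure R) `[0, t]%classic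
    (measurable_itv _) toof)//; last first.
    by move=> i; exact: sm_measurable.
  apply: eq_integral => s _; rewrite /simple_map_fun ip_suml// => i.
  exact: sm_L2.
have NB : N ^+ 2 <= N * B.
  rewrite -N2 -lee_fin vvE; apply: le_trans (lee_abs _) _.
  apply: le_trans (le_abse_integral _ _ _) _ => //.
    rewrite (_ : (fun _ => _) = (fun s => (\sum_(i < sm_size g)
        \1_(sm_set i) s * ipL2 rho (sm_val i) v)%:E)).
      have iE := @integrable_step _ _ R (@lebesgue_measure R) `[0, t]%classic
        (measurable_itv _) toof _ (@sm_set _ _ _ g)
        (fun i : 'I_(sm_size g) => ipL2 rho (sm_val i) v)
        (@sm_measurable _ _ _ g) (index_enum _).
      exact: measurable_int iE.
    apply/funext => s; rewrite /simple_map_fun ip_suml// => i.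
    exact: sm_L2.
  apply: (@le_trans _ _ (N%:E * \int[lebesgue_measure]_(s in `[0%R, t]) h s)%E).
    rewrite -ge0_integralZl_EFin//.
    - apply: le_lower_integral => s; rewrite /= in_itv/= => st.
        by rewrite lee_fin.
      apply: (@le_trans _ _ (N%:E * normL2 rho (simple_map_fun g s))%E).
        rewrite normL2E; last exact: L2_simple_map.
        by rewrite -EFinM lee_fin mulrC ip_le_norm//; exact: L2_simple_map.
      by apply: lee_wpmul2l => //; exact: gh.
    - move=> s; rewrite /= in_itv/= => st; apply: le_trans (gh s st).
      exact: poweR_ge0.
  by rewrite EFinM; apply: lee_wpmul2l.
rewrite sqnormL2E// N2 lee_fin.
have [N_eq0|N_neq0] := eqVneq N 0; first by rewrite N_eq0 expr0n sqr_ge0.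
have Npos : 0 < N by rewrite lt_neqAle eq_sym N_neq0.
by rewrite ler_sqr ?nnegrE// -(ler_pM2l Npos) -expr2.
Qed.

(** A single step map within distance 1 of the integrand in L^1(0, t; L^2(rho)),
    with an integral within distance 1 of I, gives the bound: the two errors only
    cost additive constants. *)
Lemma bochner_integral_le (t B : R) (phi : R -> Rd -> R) (I : Rd -> R)
    (H : R -> R) :
  is_bochner_integral rho t phi I -> 0 <= B -> measurable_fun `[0, t] H ->
  (forall s, 0 <= s <= t -> 0 <= H s /\
    (sqnormL2 rho (phi s) <= (H s ^+ 2)%:E)%E) ->
  (\int[lebesgue_measure]_(s in `[0%R, t]) (H s)%:E <= B%:E)%E ->
  (sqnormL2 rho I <= (2 * (B + 1) ^+ 2 + 2)%:E)%E.
Proof.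
move=> [Lphi LI [g [gphi gI]]] B0 mH phiH HB.
have /gI gI1 : nbhs (0%E : \bar R) [set y | (y < 1)%E].
  by have := @open_ereal_lt' R 0 1%E; rewrite lte_fin => /(_ ltr01).
near \oo => n.
have [h [mh gh h1]] : exists h, [/\ measurable_fun `[0, t] h,
    forall s, `[0%R, t]%classic s ->
      (normL2 rho (simple_map_fun (g n) s \- phi s)%R <= h s)%E
    & (\int[lebesgue_measure]_(x in `[0%R, t]) h x < 1)%E].
  by near: n; exact: upint_near_majorant gphi ltr01.
have gnI : (normL2 rho (simple_map_int (g n) t \- I)%R < 1)%E.
  by near: n; exact: gI1.
have h0 s : `[0%R, t]%classic s -> (0 <= h s)%E.
  by move=> st; apply: le_trans (gh s st); exact: poweR_ge0.
have Lg := L2_simple_map_int (g n) t.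
have vB : (sqnormL2 rho (simple_map_int (g n) t) <= ((B + 1) ^+ 2)%:E)%E.
  apply: (@simple_map_int_le _ _ _ (fun s => h s + (H s)%:E)%E).
  - by rewrite addr_ge0.
  - by apply: emeasurable_funD => //; exact/measurable_EFinP.
  - move=> s st; have Ls := L2_simple_map (g n) s; have Lp := Lphi s st.
    have [Hs0 Hs] := phiH s st.
    have sI : `[0%R, t]%classic s by rewrite /= in_itv.
    apply: (@le_trans _ _
      (normL2 rho (simple_map_fun (g n) s \- phi s)%R + (H s)%:E)%E).
      rewrite (_ : simple_map_fun (g n) s =
          (simple_map_fun (g n) s \- phi s) \+ phi s); last first.
        by apply/funext => x /=; rewrite subrK.
      have Lsp := L2B mrho rho0 Ls Lp.
      rewrite (_ : _ \- phi s = simple_map_fun (g n) s \- phi s); last first.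
        by apply/funext => x /=; rewrite addrK.
      rewrite !normL2E//; last exact: L2D.
      rewrite -EFinD lee_fin; apply: le_trans (sqrt_ipD Lsp Lp) _.
      rewrite lerD2l -(ger0_norm Hs0) -sqrtr_sqr ler_wsqrtr//.
      by rewrite -lee_fin -sqnormL2E.
    by rewrite leeD2r// gh.
  - rewrite ge0_integralD//.
    + by rewrite addrC EFinD leeD// ltW.
    + by move=> s; rewrite /= in_itv/= => /phiH[]; rewrite lee_fin.
    + exact/measurable_EFinP.
have := sqnormL2D mrho rho0 Lg.1 (L2B mrho rho0 LI Lg).1.
rewrite (_ : _ \+ _ = I); last by apply/funext => x /=; rewrite addrC subrK.
move=> /le_trans; apply.
rewrite (EFinD (2 * _)) (EFinM 2) leeD//; first by apply: lee_wpmul2l.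
have LIv := L2B mrho rho0 LI Lg; have LvI := L2B mrho rho0 Lg LI.
rewrite (_ : sqnormL2 rho (I \- _) =
  sqnormL2 rho (simple_map_int (g n) t \- I)); last first.
  by apply: eq_integral => x _; rewrite /= -sqrrN opprB.
move: gnI; rewrite normL2E// sqnormL2E// -EFinM lte_fin lee_fin => N1.
rewrite -[leRHS]mulr1 ler_wpM2l// -(sqr_sqrtr (ip_ge0 rho0 _)).
by rewrite expr_le1// ?sqrtr_ge0// ltW.
Unshelve. all: by end_near. Qed.

End bochner_bound.

(** * Products of independent random variables *)

Section independent_product.
Context d (Omega : measurableType d) (R : realType) (P : probability Omega R).
Local Open Scope ereal_scope.

(** Independence makes the joint law of X and Y the product of their laws, and
    the rest is Fubini. *)
Lemma indep_integral_mul (X Y : {mfun Omega >-> R}) :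
  P.-integrable setT (EFin \o X) -> P.-integrable setT (EFin \o Y) ->
  (forall A B, measurable A -> measurable B ->
    P (X @^-1` A `&` Y @^-1` B) = P (X @^-1` A) * P (Y @^-1` B)) ->
  P.-integrable setT (fun w => (X w * Y w)%:E) /\
  (\int[P]_w (X w * Y w) = (\int[P]_w X w) * (\int[P]_w Y w))%R.
Proof.
move=> iX iY XY.
pose muX : probability _ R := distribution P X.
pose muY : probability _ R := distribution P Y.
pose Z w := (X w, Y w).
have mZ : measurable_fun setT Z by exact/measurable_fun_pairP.
pose ZRV : {mfun Omega >-> (R * R)%type} :=
  HB.pack Z (isMeasurableFun.Build _ _ _ _ _ mZ).
have jointE A : measurable A -> (muX \x muY) A = distribution P ZRV A.
  by move=> mA; apply: product_measure_unique => // B C mB mC; exact: XY.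
pose f (z : R * R) : \bar R := (z.1 * z.2)%:E.
have mf : measurable_fun setT f.
  apply/measurable_EFinP; apply: measurable_funM.
    exact: measurable_fst.
  exact: measurable_snd.
have mE : measurable_fun setT (@EFin R) by exact/measurable_EFinP.
have mabs : measurable_fun setT (fun y : R => `|y%:E|).
  by apply/measurable_EFinP; exact: normr_measurable.
have iX' : muX.-integrable setT (@EFin R).
  by apply: (integrable_pushforward (phi := X)).
have iY' : muY.-integrable setT (@EFin R).
  by apply: (integrable_pushforward (phi := Y)).
have EX : \int[muX]_x x%:E = (\int[P]_w X w)%:E.
  rewrite /Rintegral fineK; last exact: integrable_fin_num.
  by rewrite (integral_pushforward (phi := X)).
have EY : \int[muY]_x x%:E = (\int[P]_w Y w)%:E.
  rewrite /Rintegral fineK; last exact: integrable_fin_num.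
  by rewrite (integral_pushforward (phi := Y)).
have iprod : (muX \x muY).-integrable setT f.
  apply/integrable12ltyP => //.
  have inner x : \int[muY]_y `|f (x, y)| = (`|x|%R)%:E * \int[muY]_y `|y%:E|.
    rewrite -ge0_integralZl_EFin//.
    by apply: eq_integral => y _; rewrite /f /= normrM.
  under eq_integral do rewrite inner.
  rewrite ge0_integralZr//; last by apply: integral_ge0 => y _; rewrite lee_fin.
  have /integrableP[_ Xoo] := iX'; have /integrableP[_ Yoo] := iY'.
  rewrite lte_mul_pinfty//.
  - by apply: integral_ge0 => y _; rewrite lee_fin.
  - rewrite ge0_fin_numE//.
    by apply: integral_ge0 => y _; rewrite lee_fin.
have ijoint : P.-integrable setT (f \o ZRV).
  apply/integrableP; split; first exact: measurableT_comp.
  have /integrableP[_] := iprod; apply: le_lt_trans.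
  rewrite (eq_measure_integral (distribution P ZRV)); last first.
    by move=> A mA _; exact: jointE.
  by rewrite ge0_integral_distribution//; apply: measurableT_comp.
split; first exact: ijoint.
rewrite {1}/Rintegral.
have -> : \int[P]_w (X w * Y w)%:E = \int[distribution P ZRV]_z f z.
  by rewrite (integral_pushforward (phi := ZRV)).
rewrite (eq_measure_integral (muX \x muY)); last first.
  by move=> A mA _; exact/esym/jointE.
rewrite -integral12_prod_meas1//.
have inner x : fubini_F muY f x = x%:E * (\int[P]_w Y w)%:E.
  by rewrite /fubini_F /f /= -EY -integralZl//; under eq_integral do rewrite EFinM.
by under eq_integral do rewrite inner; rewrite integralZr// EX.
Qed.

End independent_product.

(** * Moments of normal random variables *)

Section normal_moments.
Context {R : realType}.
Local Notation mu := (@lebesgue_measure R).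
Local Open Scope ereal_scope.

(** The density is almost everywhere the Radon-Nikodym derivative of the law,
    because both have the same integrals. *)
Lemma integral_normal_prob (m s : R) (f : R -> \bar R) :
  measurable_fun setT f -> (forall x, 0 <= f x) ->
  \int[normal_prob m s]_x f x = \int[mu]_x (f x * (normal_pdf m s x)%:E).
Proof.
move=> mf f0.
have dom := normal_prob_dominates m s.
rewrite -(Radon_Nikodym_SigmaFinite.change_of_variables dom)//.
have f_int := Radon_Nikodym_SigmaFinite.f_integrable dom.
have mpdf : measurable_fun setT (fun x : R => (normal_pdf m s x)%:E).
  by apply/measurable_EFinP; exact: measurable_normal_pdf.
apply: ge0_ae_eq_integral => //.
- by apply: emeasurable_funM => //; exact: measurable_int f_int.
- exact: emeasurable_funM.
- by move=> x _; rewrite mule_ge0// Radon_Nikodym_SigmaFinite.f_ge0.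
- by move=> x _; rewrite mule_ge0// lee_fin normal_pdf_ge0.
- apply: ae_eqe_mul2l; apply: integral_ae_eq => // A _ mA.
  by rewrite -Radon_Nikodym_SigmaFinite.f_integral.
Qed.

(** The second moment of N(0, 1), kept symbolic: by scaling, that of N(0, s^2)
    is s^2 times it, so variances of Brownian increments are proportional to
    their lengths. *)
Definition normal_m2 : R := fine (\int[mu]_x (x ^+ 2 * normal_pdf 0 1 x)%:E).

Let measurable_sq_pdf (s : R) :
  measurable_fun setT (fun x : R => (x ^+ 2 * normal_pdf 0 s x)%:E).
Proof.
apply/measurable_EFinP; apply: measurable_funM; last exact: measurable_normal_pdf.
exact: measurable_funX.
Qed.

Lemma normal_m2E : \int[mu]_x (x ^+ 2 * normal_pdf 0 1 x)%:E = normal_m2%:E.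
Proof.
rewrite /normal_m2 fineK// ge0_fin_numE; last first.
  by apply: integral_ge0 => x _; rewrite lee_fin mulr_ge0 ?sqr_ge0 ?normal_pdf_ge0.
(* Since 3/8 x^2 <= exp (3/8 x^2), the integrand is at most a multiple of
   exp (- x^2 / 8), the density of N(0, 4). *)
pose C : R := (8 / 3 * (normal_peak 1 / normal_peak 2))%R.
have p1 : (0 < normal_peak 1 :> R)%R by exact: normal_peak_gt0.
have p2 : (0 < normal_peak 2 :> R)%R by exact: normal_peak_gt0.
have C0 : (0 <= C)%R by rewrite !mulr_ge0// ltW// invr_gt0.
apply: (@le_lt_trans _ _ (C%:E * \int[mu]_x (normal_pdf 0 2 x)%:E)).
  rewrite -ge0_integralZl_EFin//.
  - apply: le_lower_integral => x _.
      by rewrite lee_fin mulr_ge0 ?sqr_ge0 ?normal_pdf_ge0.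
    rewrite -EFinM lee_fin !normal_pdfE// /normal_fun !subr0 /C.
    have -> : (8 / 3 * (normal_peak 1 / normal_peak 2) *
      (normal_peak 2 * expR (- x ^+ 2 / (2 ^+ 2 *+ 2))) =
      normal_peak 1 * (8 / 3 * expR (- x ^+ 2 / (2 ^+ 2 *+ 2))))%R.
      by field; rewrite gt_eqF.
    rewrite mulrCA ler_pM2l//.
    have -> : (- x ^+ 2 / (2 ^+ 2 *+ 2) =
        - x ^+ 2 / (1 ^+ 2 *+ 2) + 3 / 8 * x ^+ 2 :> R)%R.
      by rewrite !mulr2n; field.
    rewrite expRD mulrCA (mulrC (x ^+ 2)%R) ler_pM2l ?expR_gt0//.
    have := expR_ge1Dx (3 / 8 * x ^+ 2)%R; have := sqr_ge0 x.
    by set y := expR _; lra.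
  - by move=> x _; rewrite lee_fin normal_pdf_ge0.
  - by apply/measurable_EFinP; exact: measurable_normal_pdf.
by rewrite integral_normal_pdf mule1 ltry.
Qed.

Lemma normal_prob_sq (s : R) : (0 < s)%R ->
  \int[normal_prob 0 s]_x (x ^+ 2)%:E = (s ^+ 2 * normal_m2)%:E.
Proof.
move=> s0; rewrite integral_normal_prob//; last 2 first.
- by apply/measurable_EFinP; exact: measurable_funX.
- by move=> x; rewrite lee_fin sqr_ge0.
under eq_integral do rewrite -EFinM.
have dF (x : R) : is_derive x 1%R (fun y : R => s * y)%R s.
  by rewrite -[X in is_derive _ _ _ X]mulr1; apply: is_deriveZ.
have F'E : derive1 (fun y : R => (s * y)%R) = cst s.
  by apply/funext => x; rewrite derive1E; have [_ ->] := dF x.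
rewrite (@increasing_ge0_integration_by_substitutionT _ (fun y => s * y)%R
  (fun x => x ^+ 2 * normal_pdf 0 s x)%R); rewrite ?F'E.
- rewrite EFinM -normal_m2E -ge0_integralZl_EFin ?sqr_ge0//.
  + apply: eq_integral => x _; rewrite -EFinM; congr EFin => /=.
    have s_neq0 : s != 0%R by rewrite gt_eqF.
    rewrite !normal_pdfE// /normal_fun -[LHS]/((s * x) ^+ 2 *
      (normal_peak s * expR (- (s * x - 0) ^+ 2 / (s ^+ 2 *+ 2))) * s)%R !subr0.
    have -> : (- (s * x) ^+ 2 / (s ^+ 2 *+ 2) = - x ^+ 2 / (1 ^+ 2 *+ 2))%R.
      rewrite exprMn -mulrN -[in LHS](mulr_natr (s ^+ 2)).
      rewrite -[in RHS](mulr_natr (1 ^+ 2)).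
      by rewrite expr1n mul1r -mulf_div divff ?mul1r// expf_neq0.
    have -> : normal_peak 1 = (s * normal_peak s)%R.
      rewrite /normal_peak expr1n mul1r -mulrnAr sqrtrM ?sqr_ge0// sqrtr_sqr.
      by rewrite gtr0_norm// invfM mulrA divff// mul1r.
    by ring.
  + by move=> x _; rewrite lee_fin mulr_ge0 ?sqr_ge0 ?normal_pdf_ge0.
  + exact: measurable_sq_pdf.
- by move=> x y xy; rewrite ltr_pM2l.
- exact: cst_continuous.
- exact: is_cvg_cst.
- exact: is_cvg_cst.
- by move=> x; have [] := dF x.
- by apply: (@gt0_cvgMrNy _ _ _ s id s0).
- by apply: (@gt0_cvgMry _ _ _ s id s0).
- move=> x; apply: cvgM; first exact: sqr_continuous.
  by apply: continuous_normal_pdf; rewrite gt_eqF.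
- by move=> x; rewrite mulr_ge0 ?sqr_ge0 ?normal_pdf_ge0.
Qed.

Lemma normal_prob_mean (s : R) : (0 < s)%R ->
  (normal_prob 0 s).-integrable setT (@EFin R) /\
  \int[normal_prob 0 s]_x x%:E = 0.
Proof.
move=> s0.
have mE : measurable_fun setT (@EFin R) by exact/measurable_EFinP.
have iE : (normal_prob 0 s).-integrable setT (@EFin R).
  apply/integrableP; split => //.
  apply: (@le_lt_trans _ _
    (\int[normal_prob 0 s]_x (1 + (x ^+ 2)%:E))).
    apply: le_lower_integral => x _; first exact: abse_ge0.
    rewrite -EFinD lee_fin ler_norml; have := sqr_ge0 (x - 1)%R.
    by have := sqr_ge0 (x + 1)%R; have := sqr_ge0 x; rewrite !expr2; nra.
  rewrite ge0_integralD//; last 2 first.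
  - by move=> x _; rewrite lee_fin sqr_ge0.
  - by apply/measurable_EFinP; exact: measurable_funX.
  have N1 : normal_prob 0 s setT = 1 := probability_setT (normal_prob 0 s).
  rewrite integral_cst// mul1e normal_prob_sq// lte_add_pinfty ?ltry//.
  by apply: le_lt_trans (ltry 1); rewrite -N1.
split => //.
have sym (f : R -> \bar R) : measurable_fun setT f -> (forall x, 0 <= f x) ->
    \int[normal_prob 0 s]_x f x = \int[normal_prob 0 s]_x f (- x)%R.
  move=> mf f0.
  have mN : measurable_fun setT (-%R : R -> measurableTypeR R) by [].
  have mfN : measurable_fun setT (f \o -%R) by exact: measurableT_comp.
  rewrite !integral_normal_prob//; pose g x := f x * (normal_pdf 0 s x)%:E.
  have mg : measurable_fun setT g.
    apply: emeasurable_funM => //.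
    by apply/measurable_EFinP; exact: measurable_normal_pdf.
  transitivity (\int[pushforward mu (-%R : R -> measurableTypeR R)]_x g x).
    by apply: eq_measure_integral => A mA _; apply/esym; exact: lebesgue_measureN.
  have g0 x : 0 <= g x by rewrite mule_ge0// lee_fin normal_pdf_ge0.
  have -> := @ge0_integral_pushforward _ _ (measurableTypeR R) (measurableTypeR R)
    R _ mN (@lebesgue_measure R) setT g measurableT mg
    (fun x _ => g0 x).
  rewrite preimage_setT; apply: eq_integral => x _.
  have pdfN : normal_pdf 0 s (- x) = normal_pdf 0 s x.
    by rewrite !normal_pdfE ?gt_eqF// /normal_fun !subr0 sqrrN.
  by rewrite -pdfN.
rewrite integralE (sym (@EFin R)^\-)//; last exact: measurable_funeneg.
have -> : (fun x : R => (@EFin R)^\- (- x)%R) = (@EFin R)^\+.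
  by apply/funext => x; rewrite funenegE funeposE EFinN oppeK.
by rewrite subee// integrable_pos_fin_num.
Qed.

Context d (Omega : measurableType d) (P : probability Omega R).

Lemma normal_rv_moments (X : {mfun Omega >-> R}) (s : R) : (0 < s)%R ->
  (forall A, measurable A -> P (X @^-1` A) = normal_prob 0 s A) ->
  [/\ P.-integrable setT (EFin \o X), (\int[P]_w X w = 0)%R &
      \int[P]_w (X w ^+ 2)%:E = (s ^+ 2 * normal_m2)%:E].
Proof.
move=> s0 XE.
have mE : measurable_fun setT (@EFin R) by exact/measurable_EFinP.
have [iE E0] := normal_prob_mean s0.
have mX : measurable_fun setT (X : Omega -> measurableTypeR R) :=
  measurable_funP X.
pose X' : {mfun Omega >-> measurableTypeR R} :=
  HB.pack (X : Omega -> measurableTypeR R) (isMeasurableFun.Build _ _ _ _ _ mX).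
have lawE (f : R -> \bar R) : \int[distribution P X']_x f x =
    \int[normal_prob 0 s]_x f x.
  by apply: eq_measure_integral => A mA _; exact: XE.
have iX : P.-integrable setT (EFin \o X).
  apply/integrableP; split; first exact/measurable_EFinP.
  have /integrableP[_] := iE; rewrite -lawE ge0_integral_distribution//.
  by apply: measurableT_comp.
split => //.
  rewrite /Rintegral.
  have -> : \int[P]_w (X w)%:E = \int[distribution P X']_x x%:E.
    by rewrite (integral_pushforward (phi := X')).
  by rewrite lawE E0.
rewrite -normal_prob_sq// -lawE ge0_integral_distribution//.
  by apply/measurable_EFinP; exact: measurable_funX.
by move=> x; rewrite lee_fin sqr_ge0.
Qed.

End normal_moments.

(** * Random variables adapted to a sigma-algebra *)

Section sub_sigma_algebra.
Context d (Omega : measurableType d) (R : realType) (P : probability Omega R).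

Lemma eq_Rintegral_ae (f g : Omega -> R) :
  measurable_fun setT f -> measurable_fun setT g ->
  {ae P, forall w, f w = g w} -> \int[P]_w f w = \int[P]_w g w.
Proof.
move=> mf mg fg; rewrite /Rintegral; congr fine.
apply: ae_eq_integral => //; [exact/measurable_EFinP|exact/measurable_EFinP|].
by apply: filterS fg => w + _ => ->.
Qed.

Lemma integrable_ae_eq (f g : Omega -> R) :
  measurable_fun setT f -> measurable_fun setT g ->
  {ae P, forall w, f w = g w} ->
  P.-integrable setT (EFin \o f) -> P.-integrable setT (EFin \o g).
Proof.
move=> mf mg fg /integrableP[_ foo]; apply/integrableP; split.
  exact/measurable_EFinP.
apply: le_lt_trans foo; rewrite le_eqVlt; apply/orP; left; apply/eqP.
apply: ae_eq_integral => //.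
- by apply: measurableT_comp => //; exact/measurable_EFinP.
- by apply: measurableT_comp => //; exact/measurable_EFinP.
- by apply: filterS fg => w + _ /= => ->.
Qed.

Lemma integrable_mul_sq (f g : Omega -> R) :
  measurable_fun setT f -> measurable_fun setT g ->
  (\int[P]_w (f w ^+ 2)%:E < +oo)%E -> (\int[P]_w (g w ^+ 2)%:E < +oo)%E ->
  P.-integrable setT (fun w => (f w * g w)%:E).
Proof.
move=> mf mg foo goo; apply/integrableP; split.
  by apply/measurable_EFinP; exact: measurable_funM.
apply: (@le_lt_trans _ _ (\int[P]_w ((f w ^+ 2)%:E + (g w ^+ 2)%:E)))%E.
  apply: le_lower_integral => w _; first by rewrite lee_fin.
  rewrite -EFinD lee_fin ler_norml; have := sqr_ge0 (f w - g w)%R.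
  have := sqr_ge0 (f w + g w)%R; have := sqr_ge0 (f w); have := sqr_ge0 (g w).
  by rewrite !expr2; nra.
rewrite ge0_integralD//; last 4 first.
- by move=> w _; rewrite lee_fin sqr_ge0.
- by apply/measurable_EFinP; exact: measurable_funX.
- by move=> w _; rewrite lee_fin sqr_ge0.
- by apply/measurable_EFinP; exact: measurable_funX.
exact: lte_add_pinfty.
Qed.

Lemma integrable_indicM A (f : Omega -> R) : measurable A ->
  P.-integrable setT (EFin \o f) ->
  P.-integrable setT (fun w => (\1_A w * f w)%:E).
Proof.
move=> mA fi; have mf := measurable_int _ fi.
apply: le_integrable fi => //.
  apply/measurable_EFinP; apply: measurable_funM; first exact: measurable_indic.
  exact/measurable_EFinP.
move=> w _; rewrite /= lee_fin normrM indicE.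
by case: (w \in A); rewrite ?normr1 ?mul1r// normr0 mul0r.
Qed.

Definition adapted_fun (G : set (set Omega)) (X : Omega -> R) : Prop :=
  forall C, measurable C -> G (X @^-1` C).

Variable G : set (set Omega).
Hypothesis sG : sigma_algebra setT G.

(** With G as the sigma-algebra of a measurable space, the closure properties of
    measurable functions apply to adapted ones. *)
Lemma adapted_funP (X : Omega -> R) :
  adapted_fun G X <-> measurable_fun setT (X : g_sigma_algebraType G -> R).
Proof.
split=> [GX _ C mC|mX C mC].
  by rewrite setTI; apply: sub_sigma_algebra; exact: GX.
have := mX measurableT C mC.
by rewrite setTI -[X in X _ -> _]/(<<s G >>) sigma_algebra_id.
Qed.

Lemma adapted_funM (X Y : Omega -> R) : adapted_fun G X -> adapted_fun G Y ->
  adapted_fun G (fun w => X w * Y w).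
Proof.
by move=> /adapted_funP mX /adapted_funP mY; apply/adapted_funP;
  exact: measurable_funM.
Qed.

Lemma adapted_funB (X Y : Omega -> R) : adapted_fun G X -> adapted_fun G Y ->
  adapted_fun G (fun w => X w - Y w).
Proof.
by move=> /adapted_funP mX /adapted_funP mY; apply/adapted_funP;
  exact: measurable_funB.
Qed.

Lemma adapted_indic A : G A -> adapted_fun G \1_A.
Proof.
move=> GA; apply/adapted_funP.
by apply: (measurable_indic (T := g_sigma_algebraType G)); exact: sub_sigma_algebra.
Qed.

End sub_sigma_algebra.

Section linear_functional.
Context {R : realType} {d : nat}.
Local Notation Rd := 'rV[R]_d.
Local Notation one := (cst 1 : Rd -> R).
Local Notation L1 := (@L2 R d one).

Let m1 : measurable_fun setT one. Proof. exact: measurable_cst. Qed.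
Let one0 x : 0 <= one x. Proof. exact: ler01. Qed.

(** Continuous linear functionals are Borel on L^2: by Cauchy-Schwarz their
    strict superlevel sets are open, and rays generate the Borel sets of R. *)
Lemma L2_borel_functional g C : L1 g -> measurable C ->
  L2_borel one (L1 `&` [set v | C (ipL2 one v g)]).
Proof.
move=> Lg.
have sB : sigma_algebra L1 (L2_borel one) by exact: smallest_sigma_algebra.
have sC : sigma_algebra setT
    [set C : set R | L2_borel one (L1 `&` [set v | C (ipL2 one v g)])].
  case: sB => s0 sD sU; split => /=.
  - by rewrite (_ : _ `&` _ = set0)//; apply/seteqP; split => v // [].
  - move=> A /sD; congr (L2_borel _ _).
    apply/seteqP; split => v /= [Lv H]; split => //.
      by split => // Av; exact: H.
    by move=> [_ Av]; exact: H.2.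
  - move=> A /sU; congr (L2_borel _ _); apply/seteqP; split => v /=.
      by move=> [n _ [Lv Av]]; split => //; exists n.
    by move=> [Lv [n _ Av]]; exists n.
move=> mC; have : (@RGenOInfty.G R).-sigma.-measurable C.
  by rewrite -RGenOInfty.measurableE.
move=> hC; apply: (smallest_sub sC _ hC) => _ [x ->] /=; apply: sub_sigma_algebra.
split=> [v []//|w [Lw /=]]; rewrite in_itv/= andbT => xw.
set N := Num.sqrt (ipL2 one g g).
have N0 : 0 <= N by exact: sqrtr_ge0.
exists ((ipL2 one w g - x) / (N + 1)); first by rewrite divr_gt0 ?subr_gt0 ?ltr_wpDl.
move=> v Lv; have Lvw := L2B m1 one0 Lv Lw.
rewrite normL2E// lte_fin => vw; split => //=.
rewrite in_itv/= andbT.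
have := ip_le_norm m1 one0 Lvw Lg; rewrite ipBl// ler_norml => /andP[h _].
have : Num.sqrt (ipL2 one (v \- w) (v \- w)) * N < ipL2 one w g - x.
  rewrite ltr_pdivlMr in vw; last by rewrite ltr_wpDl.
  apply: le_lt_trans vw; rewrite ler_wpM2l ?sqrtr_ge0//.
  by rewrite lerDl.
by move: h; rewrite -/N; lra.
Qed.

End linear_functional.

(** * Increments of the Brownian motions and the filtration *)

Section increments.
Context {R : realType} {d : nat} {dO : measure_display}.
Context {Omega : measurableType dO}.
Local Notation Rd := 'rV[R]_d.
Local Notation one := (cst 1 : Rd -> R).
Local Notation L1 := (@L2 R d one).
Variable P : probability Omega R.
Variables (e : nat -> Rd -> R) (a : nat -> R) (beta : nat -> R -> Omega -> R).
Variables (W : R -> Omega -> Rd -> R) (F : R -> set (set Omega)).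
Hypothesis he : orthonormal_basis e.
Hypothesis hbeta : forall k, wiener_process P (beta k).
Hypothesis hindep : mutually_independent P (fun k => sigma_of_process (beta k)).
Hypothesis hW : is_noise P a beta e W.
Hypothesis hF : right_continuous_filtration F.
Hypothesis hWF : noise_adapted P F W.

Let m1 : measurable_fun setT one. Proof. exact: measurable_cst. Qed.
Let one0 x : 0 <= one x. Proof. exact: ler01. Qed.
Let Le k : L1 (e k). Proof. by case: he. Qed.

Let ip_e j k : ipL2 one (e j) (e k) = (j == k)%:R.
Proof.
have [_ <- _] := he; apply: eq_Rintegral => x _.
by rewrite /= mulr1.
Qed.

Definition inc k s t (w : Omega) : R := beta k t w - beta k s w.

Lemma measurable_inc k s t : 0 <= s -> 0 <= t ->
  measurable_fun setT (inc k s t).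
Proof.
by move=> s0 t0; apply: measurable_funB; apply: wiener_measurable (hbeta k) _ _.
Qed.

Lemma inc_moments k s t : 0 <= s <= t ->
  [/\ P.-integrable setT (EFin \o inc k s t), \int[P]_w inc k s t w = 0 &
      (\int[P]_w (inc k s t w ^+ 2)%:E = ((t - s) * normal_m2)%:E)%E].
Proof.
move=> /andP[s0]; rewrite le_eqVlt => /orP[/eqP <-|st].
  have inc0 w : inc k s s w = 0 by rewrite /inc subrr.
  split.
  - apply: (eq_integrable _ (cst 0%E)) => //; last exact: integrable0.
    by move=> w _; rewrite /= inc0.
  - by rewrite /Rintegral integral0_eq// => w _; rewrite inc0.
  - by rewrite subrr mul0r integral0_eq// => w _; rewrite inc0 expr0n.
have t0 : 0 <= t by rewrite (le_trans s0)// ltW.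
pose X : {mfun Omega >-> R} :=
  HB.pack (inc k s t) (isMeasurableFun.Build _ _ _ _ _ (measurable_inc k s0 t0)).
have st0 : 0 < Num.sqrt (t - s) by rewrite sqrtr_gt0 subr_gt0.
have [iX EX EX2] : [/\ P.-integrable setT (EFin \o X), \int[P]_w X w = 0 &
    (\int[P]_w (X w ^+ 2)%:E = (Num.sqrt (t - s) ^+ 2 * normal_m2)%:E)%E].
  apply: normal_rv_moments => // A mA.
  by apply: (wiener_gauss (hbeta k)) => //; rewrite s0.
by split => //; rewrite EX2 sqr_sqrtr// subr_ge0 ltW.
Qed.

Lemma integrable_incM k j s t s' t' : 0 <= s <= t -> 0 <= s' <= t' ->
  P.-integrable setT (fun w => (inc k s t w * inc j s' t' w)%:E).
Proof.
move=> st st'.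
have [_ _ h] := inc_moments k st; have [_ _ h'] := inc_moments j st'.
move/andP: st => [s0 st]; move/andP: st' => [s0' st'].
apply: integrable_mul_sq; rewrite ?h ?h' ?ltry//; apply: measurable_inc => //.
- exact: le_trans st.
- exact: le_trans st'.
Qed.

(** Pairing with e_k is continuous on L^2 and takes the same value
    sqrt(a_k) beta_k(t) on all the partial sums of W(t) of index beyond k. *)
Lemma beta_noise k t : 0 < a k -> 0 <= t ->
  {ae P, forall w, ipL2 one (W t w) (e k) = Num.sqrt (a k) * beta k t w}.
Proof.
move=> ak t0; have LW w : L1 (W t w) by exact: (hWF.1 t t0).1.
apply: filterS (hW t0) => w Wcvg; apply/eqP; rewrite -subr_eq0 -normr_le0.
apply/ler_addgt0Pr => eps eps0; rewrite add0r.
have /Wcvg h : nbhs (0%E : \bar R) [set y | (y < eps%:E)%E].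
  by have := @open_ereal_lt' R 0 eps%:E; rewrite lte_fin => /(_ eps0).
near \oo => n.
have : (normL2 one (fun x => \sum_(k < n) Num.sqrt (a k) * beta k t w * e k x
    - W t w x)%R < eps%:E)%E.
  by near: n; exact: h.
have kn : (k < n)%N by near: n; exact: nbhs_infty_gt.
pose S x := \sum_(k < n) Num.sqrt (a k) * beta k t w * e k x.
have LS : L1 S by apply: L2_sum.
rewrite -[X in normL2 _ X]/(S \- W t w); have LSW := L2B m1 one0 LS (LW w).
rewrite normL2E// lte_fin => Seps.
have := ip_le_norm m1 one0 LSW (Le k); rewrite ip_e eqxx sqrtr1 mulr1 ipBl//.
have -> : ipL2 one S (e k) = Num.sqrt (a k) * beta k t w.
  rewrite ip_suml// (bigD1 (Ordinal kn))//= ip_e eqxx mulr1 big1 ?addr0//.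
  by move=> i ik; rewrite ip_e (_ : (_ == _) = false) ?mulr0//; apply/negbTE.
by rewrite distrC => /le_trans; apply; exact: ltW.
Unshelve. all: by end_near. Qed.

Definition noise_functional g s t (w : Omega) : R :=
  ipL2 one (W t w \- W s w) g.

Lemma adapted_ipW g t : L1 g -> 0 <= t ->
  adapted_fun (F t) (fun w => ipL2 one (W t w) g).
Proof.
move=> Lg t0 C mC; have [LW FW] := hWF.1 t t0.
have := FW _ (L2_borel_functional Lg mC); congr (F t _).
by apply/seteqP; split => w /= => [[]|].
Qed.

Lemma adapted_mono s t (X : Omega -> R) : 0 <= s <= t -> adapted_fun (F s) X ->
  adapted_fun (F t) X.
Proof. by move=> st FX C mC; exact: (filtration_le hF st) (FX C mC). Qed.

Lemma adapted_measurable t (X : Omega -> R) : 0 <= t -> adapted_fun (F t) X ->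
  measurable_fun setT X.
Proof.
by move=> t0 FX _ C mC; rewrite setTI; exact: (filtration_sub hF t0) (FX C mC).
Qed.

Lemma noise_functionalE g s t w : L1 g -> 0 <= s -> 0 <= t ->
  noise_functional g s t w = ipL2 one (W t w) g - ipL2 one (W s w) g.
Proof.
move=> Lg s0 t0; rewrite /noise_functional ipBl//.
  exact: (hWF.1 t t0).1.
exact: (hWF.1 s s0).1.
Qed.

Lemma measurable_noise_functional g s t : L1 g -> 0 <= s -> 0 <= t ->
  measurable_fun setT (noise_functional g s t).
Proof.
move=> Lg s0 t0.
rewrite (_ : noise_functional g s t =
  (fun w => ipL2 one (W t w) g) \- (fun w => ipL2 one (W s w) g)); last first.
  by apply/funext => w; exact: noise_functionalE.
apply: measurable_funB; [apply: (@adapted_measurable t)|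
  apply: (@adapted_measurable s)] => //; exact: adapted_ipW.
Qed.

Lemma noise_functional_indep g s t A C : L1 g -> 0 <= s < t -> F s A ->
  measurable C ->
  (P (A `&` noise_functional g s t @^-1` C) =
   P A * P (noise_functional g s t @^-1` C))%E.
Proof.
move=> Lg st FA mC.
have := hWF.2 s t st A _ FA (L2_borel_functional Lg mC).
have s0 : 0 <= s by case/andP: st.
have t0 : 0 <= t by case/andP: st => _ /ltW; exact: le_trans.
rewrite (_ : (fun w => W t w \- W s w) @^-1` _ = noise_functional g s t @^-1` C)//.
apply/seteqP; split => w /= => [[]//|]; split => //.
by apply: L2B => //; [exact: (hWF.1 t t0).1|exact: (hWF.1 s s0).1].
Qed.

(** The preimages of Borel sets by X belong to F_s, hence are independent of the
    increment of W after time s. *)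
Lemma indep_past (X : Omega -> R) (h : R -> R) g s t :
  L1 g -> 0 <= s < t -> adapted_fun (F s) X ->
  measurable_fun setT h -> P.-integrable setT (EFin \o X) ->
  P.-integrable setT (fun w => (h (noise_functional g s t w))%:E) ->
  P.-integrable setT (fun w => (X w * h (noise_functional g s t w))%:E) /\
  \int[P]_w (X w * h (noise_functional g s t w)) =
    (\int[P]_w X w) * \int[P]_w h (noise_functional g s t w).
Proof.
move=> Lg st FX mh iX iY.
have s0 : 0 <= s by case/andP: st.
have t0 : 0 <= t by case/andP: st => _ /ltW; exact: le_trans.
have mX : measurable_fun setT X by exact: adapted_measurable FX.
have mY : measurable_fun setT (h \o noise_functional g s t).
  by apply: measurableT_comp => //; exact: measurable_noise_functional.
pose X' : {mfun Omega >-> R} := HB.pack X (isMeasurableFun.Build _ _ _ _ _ mX).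
pose Y' : {mfun Omega >-> R} := HB.pack (h \o noise_functional g s t)
  (isMeasurableFun.Build _ _ _ _ _ mY).
apply: (@indep_integral_mul _ _ _ P X' Y') => // A B mA mB.
rewrite /Y' /= comp_preimage; apply: noise_functional_indep => //.
  exact: FX.
by rewrite -[X in measurable X]setTI; exact: mh.
Qed.


(** The functional that extracts beta_k from W. *)
Let g k : Rd -> R := fun x => (Num.sqrt (a k))^-1 * e k x.

Let Lg k : L1 (g k). Proof. exact: L2Z. Qed.

Let noise_inc k s t : 0 < a k -> 0 <= s -> 0 <= t ->
  {ae P, forall w, noise_functional (g k) s t w = inc k s t w}.
Proof.
move=> ak s0 t0.
have key r : 0 <= r ->
    {ae P, forall w, ipL2 one (W r w) (g k) = beta k r w}.
  move=> r0; apply: filterS (beta_noise ak r0) => w.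
  have LW : L1 (W r w) by exact: (hWF.1 r r0).1.
  by move=> h; rewrite ipC /g ipZl// ipC h mulKf// gt_eqF// sqrtr_gt0.
apply: filterS2 (key s s0) (key t t0) => w hs ht.
by rewrite noise_functionalE// hs ht.
Qed.

(** The later increment is a functional of the increment of W after time s: it
    is centered and independent of the earlier one and of A. *)
Lemma inc_orthogonal k j q s t A : 0 < a k -> 0 < a j ->
  0 <= q <= s -> s <= t -> F s A ->
  \int[P]_w (\1_A w * (inc k q s w * inc j s t w)) = 0.
Proof.
move=> ak aj qs st FA; have [q0 s0] : 0 <= q /\ 0 <= s.
  by case/andP: qs => q0 qs; split => //; exact: le_trans qs.
have t0 : 0 <= t by exact: le_trans st.
have mA : measurable A by exact: (filtration_sub hF s0).
move: st; rewrite le_eqVlt => /orP[/eqP <-|st].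
  by rewrite /Rintegral integral0_eq// => w _; rewrite /inc subrr !mulr0.
pose X w := \1_A w * (ipL2 one (W s w) (g k) - ipL2 one (W q w) (g k)).
have FX : adapted_fun (F s) X.
  have sF := filtration_sigma hF s0.
  apply: adapted_funM => //; first exact: adapted_indic.
  apply: adapted_funB => //; first exact: adapted_ipW.
  by apply: (adapted_mono qs); exact: adapted_ipW.
have mX := adapted_measurable s0 FX.
have mink := measurable_inc k q0 s0; have minj := measurable_inc j s0 t0.
have mN : measurable_fun setT (noise_functional (g j) s t).
  exact: measurable_noise_functional.
have XE : {ae P, forall w, X w = \1_A w * inc k q s w}.
  apply: filterS (noise_inc ak q0 s0) => w.
  by rewrite noise_functionalE// /X => ->.
have mindA (f : Omega -> R) : measurable_fun setT f ->
    measurable_fun setT (fun w => \1_A w * f w).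
  by move=> mf; apply: measurable_funM => //; exact: measurable_indic.
have [ik _ _] := inc_moments k qs.
have st2 : 0 <= s <= t by rewrite s0 ltW.
have [ij ij0 _] := inc_moments j st2.
have iX : P.-integrable setT (EFin \o X).
  apply: (@integrable_ae_eq _ _ _ P (fun w => \1_A w * inc k q s w)) => //.
  - exact: mindA.
  - by apply: filterS XE => w ->.
  - exact: integrable_indicM.
have iN : P.-integrable setT (EFin \o noise_functional (g j) s t).
  apply: (@integrable_ae_eq _ _ _ P (inc j s t)) => //.
  by apply: filterS (noise_inc aj s0 t0) => w ->.
have st' : 0 <= s < t by rewrite s0.
have [_ h] := indep_past (h := id) (Lg j) st' FX (@measurable_id _ _ _) iX iN.
rewrite -[RHS](mulr0 (\int[P]_w X w)) -ij0.
rewrite (@eq_Rintegral_ae _ _ _ P (inc j s t) (noise_functional (g j) s t))//.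
  rewrite -h; apply: eq_Rintegral_ae.
  - by apply: mindA; exact: measurable_funM.
  - exact: measurable_funM.
  - apply: filterS2 XE (noise_inc aj s0 t0) => w -> ->.
    by rewrite mulrA.
by apply: filterS (noise_inc aj s0 t0) => w ->.
Qed.

Lemma inc_covariance k j s t : 0 <= s <= t ->
  \int[P]_w (inc k s t w * inc j s t w) = (k == j)%:R * ((t - s) * normal_m2).
Proof.
move=> st; have [s0 t0] : 0 <= s /\ 0 <= t.
  by case/andP: st => s0 st; split => //; exact: le_trans st.
have [<-|kj] := eqVneq k j.
  have [_ _ h] := inc_moments k st.
  by rewrite mul1r /Rintegral; under eq_integral do rewrite -expr2; rewrite h.
rewrite mul0r.
have minc i : measurable_fun setT (inc i s t) by exact: measurable_inc.
pose X i : {mfun Omega >-> R} :=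
  HB.pack (inc i s t) (isMeasurableFun.Build _ _ _ _ _ (minc i)).
have iX i : P.-integrable setT (EFin \o X i) by have [] := inc_moments i st.
have [_ ->] : P.-integrable setT (fun w => (X k w * X j w)%:E) /\
    \int[P]_w (X k w * X j w) = (\int[P]_w X k w) * (\int[P]_w X j w).
  apply: indep_integral_mul => // B C mB mC.
  have adap i D : measurable D -> sigma_of_process (beta i) (X i @^-1` D).
    have bad r : 0 <= r -> measurable_fun setT (beta i r :
        g_sigma_algebraType (\bigcup_(t in [set t | 0 <= t])
          preimage_set_system setT (beta i t) measurable) -> R).
      move=> r0 _ E mE; rewrite setTI; apply: sub_sigma_algebra.
      by exists r => //; exists E => //; rewrite setTI.
    move=> mD.
    have := measurable_funB (bad t t0) (bad s s0) measurableT mD.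
    by rewrite setTI.
  (* An event of the sigma-algebra of beta_k and one of that of beta_j. *)
pose A i := if i == k then X k @^-1` B else X j @^-1` C.
  have := hindep (J := [:: k; j]) (A := A).
  rewrite /= inE kj !big_cons big_nil mule1 => /(_ isT).
  rewrite (_ : \bigcap_(i in _) _ = X k @^-1` B `&` X j @^-1` C).
    rewrite /A eqxx eq_sym (negbTE kj) => -> // i.
    rewrite !inE => /orP[] /eqP ->; rewrite ?eqxx; first exact: adap.
    by rewrite eq_sym (negbTE kj); exact: adap.
  rewrite /A; apply/seteqP; split => w /=.
    move=> h; split; first by have := h k; rewrite /= !inE eqxx; exact.
    by have := h j; rewrite /= !inE eqxx orbT eq_sym (negbTE kj); exact.
  move=> [wB wC] i /=; rewrite !inE => /orP[] /eqP ->; rewrite ?eqxx//.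
  by rewrite eq_sym (negbTE kj).
by have [_ -> _] := inc_moments k st; rewrite mul0r.
Qed.

(** By polarization, the product of the two increments is a difference of squares
    of linear functionals of the increment of W after time s, and these squares
    are independent of F_s. *)
Lemma inc_covariance_past k j s t A : 0 < a k -> 0 < a j ->
  0 <= s <= t -> F s A ->
  \int[P]_w (\1_A w * (inc k s t w * inc j s t w)) =
    fine (P A) * ((k == j)%:R * ((t - s) * normal_m2)).
Proof.
move=> ak aj st FA; rewrite -inc_covariance//.
have [s0 t0] : 0 <= s /\ 0 <= t.
  by case/andP: st => s0 st; split => //; exact: le_trans st.
have mA : measurable A by exact: (filtration_sub hF s0).
case/andP: (st) => _; rewrite le_eqVlt => /orP[/eqP <-|lt_st].
  rewrite /Rintegral !integral0_eq ?mulr0// => w _.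
    by rewrite /inc subrr mul0r.
  by rewrite /inc subrr mul0r mulr0.
have st' : 0 <= s < t by rewrite s0.
have minc i : measurable_fun setT (inc i s t) by exact: measurable_inc.
have mindA (f : Omega -> R) : measurable_fun setT f ->
    measurable_fun setT (fun w => \1_A w * f w).
  by move=> mf; apply: measurable_funM => //; exact: measurable_indic.
have i1 : P.-integrable setT (EFin \o \1_A).
  exact: integrable_indic.
have E1 : \int[P]_w \1_A w = fine (P A).
  by rewrite /Rintegral integral_indic// setIT.
pose V (b : bool) w := inc k s t w + (-1) ^+ b * inc j s t w.
have iVV b : P.-integrable setT (fun w => (V b w ^+ 2)%:E).
  have := integrableD measurableT (integrableD measurableT
    (integrable_incM k k st st) (integrable_incM j j st st))
    (integrableZl measurableT (2 * (-1) ^+ b) (integrable_incM k j st st)).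
  apply: eq_integrable => // w _ /=; rewrite -!EFinM -!EFinD /V; congr EFin.
  by case: b; rewrite ?expr1 ?expr0; ring.
have mV b : measurable_fun setT (V b).
  by apply: measurable_funD => //; exact: measurable_funM.
have sq b : \int[P]_w (\1_A w * V b w ^+ 2) =
    fine (P A) * \int[P]_w (V b w ^+ 2).
  pose G := g k \+ (fun x => (-1) ^+ b * g j x).
  have LG : L1 G by apply: L2D => //; exact: L2Z.
  have mN : measurable_fun setT (noise_functional G s t).
    exact: measurable_noise_functional.
  have NV : {ae P, forall w, noise_functional G s t w = V b w}.
    apply: filterS2 (noise_inc ak s0 t0) (noise_inc aj s0 t0) => w.
    rewrite /V => <- <-; rewrite /noise_functional.
    have LWW : L1 (W t w \- W s w).
      by apply: L2B => //; [exact: (hWF.1 t t0).1|exact: (hWF.1 s s0).1].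
    rewrite ipC ipDl//; last exact: L2Z.
    by rewrite (ipZl m1 one0 ((-1) ^+ b) (Lg j) LWW) (ipC _ (g k)) (ipC _ (g j)).
  have iN : P.-integrable setT (fun w => (noise_functional G s t w ^+ 2)%:E).
    apply: (@integrable_ae_eq _ _ _ P (fun w => V b w ^+ 2)) => //.
    - exact: measurable_funX.
    - exact: measurable_funX.
    - by apply: filterS NV => w ->.
    - exact: iVV.
  have FX : adapted_fun (F s) (\1_A : Omega -> R).
    by have sF := filtration_sigma hF s0; apply: adapted_indic.
  have [_] := indep_past (h := fun x => x ^+ 2) LG st' FX
    (measurable_funX _ (@measurable_id _ _ _)) i1 iN.
  rewrite E1 => h.
  rewrite (@eq_Rintegral_ae _ _ _ P (fun w => V b w ^+ 2)
    (fun w => noise_functional G s t w ^+ 2)).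
  - rewrite -h; apply: eq_Rintegral_ae.
    + by apply: mindA; exact: measurable_funX.
    + by apply: mindA; exact: measurable_funX.
    + by apply: filterS NV => w ->.
  - exact: measurable_funX.
  - exact: measurable_funX.
  - by apply: filterS NV => w ->.
have polar w : inc k s t w * inc j s t w =
    4^-1 * V false w ^+ 2 - 4^-1 * V true w ^+ 2.
  by rewrite /V expr1 expr0; field.
have iAVV b : P.-integrable setT (fun w => (\1_A w * V b w ^+ 2)%:E).
  exact: (integrable_indicM (f := fun w => V b w ^+ 2) mA (iVV b)).
have polarE (f f0 f1 : Omega -> R) : P.-integrable setT (EFin \o f0) ->
    P.-integrable setT (EFin \o f1) ->
    (forall w, f w = 4^-1 * f0 w - 4^-1 * f1 w) ->
    \int[P]_w f w = 4^-1 * \int[P]_w f0 w - 4^-1 * \int[P]_w f1 w.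
  move=> i0 i1' fE; rewrite -(RintegralZl _ measurableT i0).
  rewrite -(RintegralZl _ measurableT i1') -RintegralB//.
  - by apply: eq_Rintegral => w _; rewrite fE.
  - exact: (integrableZl measurableT 4^-1 i0).
  - exact: (integrableZl measurableT 4^-1 i1').
rewrite (polarE _ _ _ (iAVV false) (iAVV true)); last first.
  by move=> w; rewrite polar; ring.
rewrite (polarE (fun w => inc k s t w * inc j s t w) _ _
  (iVV false) (iVV true)); last exact: polar.
by rewrite !sq; ring.
Qed.

End increments.

(** * Ito's isometry for several Brownian motions *)

Lemma integrable_Rsum dT (T : measurableType dT) (R : realType)
    (mu : {measure set T -> \bar R}) (D : set T) (I : Type) (s : seq I)
    (f : I -> T -> R) : measurable D ->
  (forall i, mu.-integrable D (fun x => (f i x)%:E)) ->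
  mu.-integrable D (fun x => (\sum_(i <- s) f i x)%:E).
Proof.
move=> mD fi; have := @integrable_sum _ _ _ mu D mD I s xpredT
    (fun i x => (f i x)%:E) (fun i _ => fi i).
by apply: eq_integrable => // x _; rewrite sumEFin.
Qed.

Lemma Rintegral_sum dT (T : measurableType dT) (R : realType)
    (mu : {measure set T -> \bar R}) (D : set T) (I : Type) (s : seq I)
    (f : I -> T -> R) : measurable D ->
  (forall i, mu.-integrable D (fun x => (f i x)%:E)) ->
  \int[mu]_(x in D) (\sum_(i <- s) f i x) =
  \sum_(i <- s) \int[mu]_(x in D) f i x.
Proof.
move=> mD fi; elim: s => [|i s IH].
  rewrite big_nil /Rintegral integral0_eq// => x _; by rewrite big_nil.
under eq_Rintegral do rewrite big_cons.
rewrite (RintegralD mD (fi i) (integrable_Rsum s mD fi)).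
by rewrite IH big_cons.
Qed.

Section ito_isometry.
Context {R : realType} {d : nat} {dO : measure_display}.
Context {Omega : measurableType dO}.
Local Notation Rd := 'rV[R]_d.
Variable P : probability Omega R.
Variables (a : nat -> R) (beta : nat -> R -> Omega -> R).
Variables (F : R -> set (set Omega)) (m2 : R).
Hypothesis hF : right_continuous_filtration F.
Local Notation inc := (inc beta).
Hypothesis iinc : forall k j s t s' t', 0 <= s <= t -> 0 <= s' <= t' ->
  P.-integrable setT (fun w => (inc k s t w * inc j s' t' w)%:E).
Hypothesis orth : forall k j q s t A, 0 < a k -> 0 < a j ->
  0 <= q <= s -> s <= t -> F s A ->
  \int[P]_w (\1_A w * (inc k q s w * inc j s t w)) = 0.
Hypothesis cov : forall k j s t A, 0 < a k -> 0 < a j -> 0 <= s <= t -> F s A ->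
  \int[P]_w (\1_A w * (inc k s t w * inc j s t w)) =
    fine (P A) * ((k == j)%:R * ((t - s) * m2)).

Let E B k s t j s' t' : R :=
  \int[P]_w (\1_B w * (inc k s t w * inc j s' t' w)).

Let iany k j s t s' t' : 0 <= s -> 0 <= t -> 0 <= s' -> 0 <= t' ->
  P.-integrable setT (fun w => (inc k s t w * inc j s' t' w)%:E).
Proof.
have incN i p q w : inc i p q w = - inc i q p w by rewrite /inc opprB.
have half i p q i' p' q' : 0 <= p -> 0 <= q -> 0 <= p' <= q' ->
    P.-integrable setT (fun w => (inc i p q w * inc i' p' q' w)%:E).
  move=> p0 q0 pq'; have [pq|/ltW qp] := leP p q.
    by apply: iinc => //; rewrite p0.
  have := integrableN (iinc i i' _ pq' : P.-integrable setT _).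
  move=> /(_ q p); rewrite q0 qp => /(_ isT) /=.
  by apply: eq_integrable => // w _; rewrite /= (incN i p q) mulNr.
move=> s0 t0 s0' t0'; have [st|/ltW ts] := leP s' t'.
  by apply: half => //; rewrite s0'.
have h : 0 <= t' <= s' by rewrite t0'.
have := integrableN (half k s t j t' s' s0 t0 h).
by apply: eq_integrable => // w _; rewrite /= (incN j s' t') mulrN.
Qed.

Let iindic B k s t j s' t' : measurable B ->
  0 <= s -> 0 <= t -> 0 <= s' -> 0 <= t' ->
  P.-integrable setT (fun w => (\1_B w * (inc k s t w * inc j s' t' w))%:E).
Proof.
move=> mB s0 t0 s0' t0'.
exact: (integrable_indicM (f := fun w => inc k s t w * inc j s' t' w) mB
  (iany k j s0 t0 s0' t0')).
Qed.

Let EC B k s t j s' t' : E B k s t j s' t' = E B j s' t' k s t.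
Proof. by apply: eq_Rintegral => w _; rewrite (mulrC (inc k s t w)). Qed.

Let Esplit B k s m t j s' t' : measurable B -> 0 <= s -> 0 <= m -> 0 <= t ->
  0 <= s' -> 0 <= t' ->
  E B k s t j s' t' = E B k s m j s' t' + E B k m t j s' t'.
Proof.
move=> mB s0 m0 t0 s0' t0'; rewrite /E -RintegralD//; [|exact: iindic..].
by apply: eq_Rintegral => w _; rewrite /inc; ring.
Qed.

Let Eflip B k s t j s' t' : measurable B -> 0 <= s -> 0 <= t ->
  0 <= s' -> 0 <= t' -> E B k s t j s' t' = - E B k t s j s' t'.
Proof.
move=> mB s0 t0 s0' t0'; apply/eqP; rewrite -addr_eq0 -Esplit//.
by rewrite /E /Rintegral integral0_eq// => w _; rewrite /inc subrr mul0r mulr0.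
Qed.

Let lambda (S : set R) : R := fine (lebesgue_measure S).

(** Both increments are cut at the ends of the overlap of the two intervals. Only
    the product of the common increments survives: in every other product one
    factor comes after the other and after B. *)
Let inc_overlap_le k j l r l' r' B : 0 < a k -> 0 < a j ->
  0 <= l <= r -> l <= l' -> l' <= r' -> F l' B ->
  E B k l r j l' r' = fine (P B) *
    ((k == j)%:R * (lambda (`]l, r]%classic `&` `]l', r']%classic) * m2)).
Proof.
move=> ak aj /andP[l0 lr] ll' lr' FB.
have l0' : 0 <= l' by exact: le_trans ll'.
have r0 : 0 <= r by exact: le_trans lr.
have r0' : 0 <= r' by exact: le_trans lr'.
have mB : measurable B by exact: (filtration_sub hF l0').
have Fmono t : l' <= t -> F t B.
  by move=> lt; apply: (filtration_le hF _ FB); rewrite l0'.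
have -> : `]l, r]%classic `&` `]l', r']%classic = `]l', (Num.min r r')]%classic.
  apply/seteqP; split => x /=; rewrite !in_itv/= le_min.
    by move=> [/andP[_ ->] /andP[-> ->]].
  by move=> /andP[xl /andP[-> ->]]; rewrite xl (le_lt_trans ll').
rewrite /lambda lebesgue_measure_itv/= lte_fin.
rewrite (@Esplit _ _ _ l')// {1}/E orth ?l0// add0r.
have [lr1|rl'] := ltP l' r; last first.
  rewrite Eflip// {1}/E orth ?r0// oppr0 ifF ?mul0r ?mulr0//.
  by apply/negbTE; rewrite -leNgt ge_min rl'.
have [rr'|/ltW r'r] := leP r r'.
  rewrite lr1 -EFinD /= EC (@Esplit _ _ _ r)// -EC [X in _ + X]EC {2}/E.
  rewrite orth ?l0' ?(ltW lr1)//; last exact/Fmono/ltW.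
  by rewrite addr0 /E cov ?l0' ?(ltW lr1).
rewrite (@Esplit _ _ _ r')// (EC _ k r') {2}/E orth ?l0'//; last exact: Fmono.
rewrite addr0 /E cov ?l0'//; congr (_ * (_ * (_ * _))).
case: ifPn => [_|]; first by rewrite -EFinD.
by rewrite -leNgt => r'l; apply/eqP; rewrite subr_eq0 eq_le r'l.
Qed.

Let inc_overlap k j l r l' r' A A' : 0 < a k -> 0 < a j ->
  0 <= l <= r -> 0 <= l' <= r' -> F l A -> F l' A' ->
  E (A `&` A') k l r j l' r' = fine (P (A `&` A')) *
    ((k == j)%:R * (lambda (`]l, r]%classic `&` `]l', r']%classic) * m2)).
Proof.
move=> ak aj lr lr' FA FA'.
have FI t B C : 0 <= t -> F t B -> F t C -> F t (B `&` C).
  move=> t0 FB FC.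
  rewrite -(sigma_algebra_id (filtration_sigma hF t0)) in FB FC *.
  exact: (@measurableI _ (g_sigma_algebraType (F t)) B C FB FC).
have [ll'|/ltW l'l] := leP l l'.
  case/andP: lr' => l0' lr'; apply: inc_overlap_le => //.
  apply: FI => //; apply: (filtration_le hF _ FA).
  by case/andP: lr => ->.
rewrite EC setIC (setIC `]l, r]%classic) eq_sym.
case/andP: lr => l0 lr; apply: inc_overlap_le => //.
apply: FI => //; apply: (filtration_le hF _ FA').
by case/andP: lr' => ->.
Qed.


Variable T : R.
Hypothesis T0 : 0 <= T.
Variable rho : Rd -> R.
Hypothesis mrho : measurable_fun setT rho.
Hypothesis rho0 : forall x, 0 <= rho x.
Local Notation ep := (elementary_process rho F).

Definition ep_overlap (Phi Psi : ep)
    (i : 'I_(ep_size Phi)) (j : 'I_(ep_size Psi)) : R :=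
  fine (lebesgue_measure
    ((`]ep_left i, ep_right i]%classic `&`
      `]ep_left j, ep_right j]%classic) `&` `[0%R, T]%classic)).

Let coef k (Phi : ep) (i : 'I_(ep_size Phi)) w : R := \1_(ep_event i) w *
  inc k (Num.min (ep_left i) T) (Num.min (ep_right i) T) w.

Let ev_measurable (Phi : ep) (i : 'I_(ep_size Phi)) : measurable (ep_event i).
Proof.
apply: (filtration_sub hF _ (ep_adapted i)).
by case/andP: (ep_le i).
Qed.

Let min_ge0 x : 0 <= x -> 0 <= Num.min x T.
Proof. by move=> x0; rewrite le_min x0. Qed.

Let left_ge0 (Phi : ep) (i : 'I_(ep_size Phi)) : 0 <= ep_left i.
Proof. by case/andP: (ep_le i). Qed.

Let right_ge0 (Phi : ep) (i : 'I_(ep_size Phi)) : 0 <= ep_right i.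
Proof. by case/andP: (ep_le i) => l0; exact: le_trans. Qed.

Let coefM k j (Phi Psi : ep) (i : 'I_(ep_size Phi)) (i' : 'I_(ep_size Psi)) w :
  coef k i w * coef j i' w =
  \1_(ep_event i `&` ep_event i') w *
  (inc k (Num.min (ep_left i) T) (Num.min (ep_right i) T) w *
   inc j (Num.min (ep_left i') T) (Num.min (ep_right i') T) w).
Proof. by rewrite /coef indicI/=; ring. Qed.

Let coef_integrable k j (Phi Psi : ep)
    (i : 'I_(ep_size Phi)) (i' : 'I_(ep_size Psi)) :
  P.-integrable setT (fun w => (coef k i w * coef j i' w)%:E).
Proof.
have mI : measurable (ep_event i `&` ep_event i') by exact: measurableI.
have := iindic k j mI (min_ge0 (left_ge0 i)) (min_ge0 (right_ge0 i))
  (min_ge0 (left_ge0 i')) (min_ge0 (right_ge0 i')).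
by apply: eq_integrable => // w _; rewrite /= -coefM.
Qed.

Let coef_cov k j (Phi Psi : ep)
    (i : 'I_(ep_size Phi)) (i' : 'I_(ep_size Psi)) : 0 < a k -> 0 < a j ->
  \int[P]_w (coef k i w * coef j i' w) =
  fine (P (ep_event i `&` ep_event i')) *
    ((k == j)%:R * (ep_overlap i i' * m2)).
Proof.
move=> ak aj; under eq_Rintegral do rewrite coefM.
set l := ep_left i; set r := ep_right i.
set l' := ep_left i'; set r' := ep_right i'.
(* A step that starts after T has a null increment and an empty overlap with
   [0, T]. *)
have [lT|Tl] := leP l T; last first.
  have Tr : T <= r by apply: le_trans (ltW Tl) _; case/andP: (ep_le i).
  rewrite (min_r Tr) /ep_overlap -/l -/r.
  rewrite (_ : _ `&` `[0%R, T]%classic = set0) ?measure0 ?mul0r ?mulr0.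
    by rewrite /Rintegral integral0_eq// => w _; rewrite /inc subrr mul0r mulr0.
  apply/seteqP; split => x //=; rewrite ?in_itv/=.
  move=> [[/andP[lx _] _] /andP[_ xT]].
  by have := lt_le_trans (lt_trans Tl lx) xT; rewrite ltxx.
have [lT'|Tl'] := leP l' T; last first.
  have Tr : T <= r' by apply: le_trans (ltW Tl') _; case/andP: (ep_le i').
  rewrite (min_r Tr) /ep_overlap -/l' -/r'.
  rewrite (_ : _ `&` `[0%R, T]%classic = set0) ?measure0 ?mul0r ?mulr0.
    by rewrite /Rintegral integral0_eq// => w _; rewrite /inc subrr mulr0 mulr0.
  apply/seteqP; split => x //=; rewrite ?in_itv/=.
  move=> [[_ /andP[lx _]] /andP[_ xT]].
  by have := lt_le_trans (lt_trans Tl' lx) xT; rewrite ltxx.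
have lr : 0 <= l <= Num.min r T.
  by rewrite le_min lT left_ge0 andbT; case/andP: (ep_le i).
have lr' : 0 <= l' <= Num.min r' T.
  by rewrite le_min lT' left_ge0 andbT; case/andP: (ep_le i').
have := inc_overlap ak aj lr lr' (ep_adapted i) (ep_adapted i').
rewrite /E => ->; congr (_ * (_ * (fine (lebesgue_measure _) * _))).
apply/seteqP; split => x /=; rewrite !in_itv/= !le_min.
  move=> [/andP[lx /andP[xr xT]] /andP[lx' /andP[xr' _]]].
  by rewrite lx xr lx' xr' xT (le_trans (left_ge0 i))// ltW.
by move=> [[/andP[-> ->] /andP[-> ->]] /andP[_ ->]].
Qed.

Let elementary_intE k (Phi : ep) w : elementary_int Phi (beta k) T w =
  fun x => \sum_(i < ep_size Phi) coef k i w * ep_val i x.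
Proof. by []. Qed.

Lemma L2_elementary_int k (Phi : ep) w :
  L2 rho (elementary_int Phi (beta k) T w).
Proof. by apply: L2_sum => // i; exact: ep_L2. Qed.

Lemma L2_elementary_fun (Phi : ep) s w : L2 rho (elementary_fun Phi s w).
Proof. by apply: L2_sum => // i; exact: ep_L2. Qed.

Let ip_sum2 (m n : nat) (c : 'I_m -> R) (c' : 'I_n -> R)
    (v : 'I_m -> Rd -> R) (v' : 'I_n -> Rd -> R) :
  (forall i, L2 rho (v i)) -> (forall i, L2 rho (v' i)) ->
  ipL2 rho (fun x => \sum_i c i * v i x) (fun x => \sum_i c' i * v' i x) =
  \sum_(p : 'I_m * 'I_n) (c p.1 * c' p.2) * ipL2 rho (v p.1) (v' p.2).
Proof.
move=> Lv Lv'; have Lc' := L2_sum mrho rho0 (index_enum 'I_n) c' Lv'.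
rewrite ip_suml// -(pair_big xpredT xpredT
  (fun i j => (c i * c' j) * ipL2 rho (v i) (v' j)))/=.
apply: eq_bigr => i _; rewrite ipC ip_suml// mulr_sumr.
by apply: eq_bigr => j _; rewrite ipC; ring.
Qed.

(** The squared norm of Phi in L^2([0, T] x Omega; L^2(rho)), expanded over pairs
    of steps. *)
Definition ep_energy (Phi : ep) : R :=
  \sum_(p : 'I_(ep_size Phi) * 'I_(ep_size Phi))
    fine (P (ep_event p.1 `&` ep_event p.2)) *
    ep_overlap p.1 p.2 * ipL2 rho (ep_val p.1) (ep_val p.2).

Let ip_intE k j (Phi Psi : ep) w :
  ipL2 rho (elementary_int Phi (beta k) T w) (elementary_int Psi (beta j) T w) =
  \sum_(p : 'I_(ep_size Phi) * 'I_(ep_size Psi))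
    (coef k p.1 w * coef j p.2 w) * ipL2 rho (ep_val p.1) (ep_val p.2).
Proof. by rewrite !elementary_intE ip_sum2// => i; exact: (ep_L2 i). Qed.

Let ip_int_integrable k j (Phi Psi : ep) : P.-integrable setT (fun w =>
  (ipL2 rho (elementary_int Phi (beta k) T w)
            (elementary_int Psi (beta j) T w))%:E).
Proof.
have fi (p : 'I_(ep_size Phi) * 'I_(ep_size Psi)) := integrableZr measurableT
  (ipL2 rho (ep_val p.1) (ep_val p.2))
  (coef_integrable k j p.1 p.2).
have := integrable_Rsum (index_enum _) measurableT fi.
apply: eq_integrable => // w _ /=.
by rewrite ip_intE.
Qed.

Let ip_int_expectation k j (Phi Psi : ep) : 0 < a k -> 0 < a j -> k != j ->
  \int[P]_w ipL2 rho (elementary_int Phi (beta k) T w)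
            (elementary_int Psi (beta j) T w) = 0.
Proof.
move=> ak aj kj.
have fi (p : 'I_(ep_size Phi) * 'I_(ep_size Psi)) := integrableZr measurableT
  (ipL2 rho (ep_val p.1) (ep_val p.2))
  (coef_integrable k j p.1 p.2).
under eq_Rintegral do rewrite ip_intE.
rewrite (Rintegral_sum _ measurableT fi) big1// => p _.
rewrite RintegralZr//; last exact: coef_integrable.
by rewrite coef_cov// (negbTE kj) mul0r mulr0 mul0r.
Qed.

Let sq_int_expectation k (Phi : ep) : 0 < a k ->
  \int[P]_w ipL2 rho (elementary_int Phi (beta k) T w)
            (elementary_int Phi (beta k) T w) = m2 * ep_energy Phi.
Proof.
move=> ak.
have fi (p : 'I_(ep_size Phi) * 'I_(ep_size Phi)) := integrableZr measurableT
  (ipL2 rho (ep_val p.1) (ep_val p.2))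
  (coef_integrable k k p.1 p.2).
under eq_Rintegral do rewrite ip_intE.
rewrite (Rintegral_sum _ measurableT fi) mulr_sumr; apply: eq_bigr => p _.
rewrite RintegralZr//; last exact: coef_integrable.
by rewrite coef_cov// eqxx mul1r; ring.
Qed.

Lemma ep_energyE (Phi : ep) :
  (\int[(lebesgue_measure \x P)%E]_(sw in `[0%R, T] `*` setT)
    sqnormL2 rho (elementary_fun Phi sw.1 sw.2) = (ep_energy Phi)%:E)%E.
Proof.
pose D : set (measurableTypeR R * Omega) := `[0%R, T]%classic `*` setT.
have mD : measurable D by exact: measurableX.
have lT : ((@lebesgue_measure R) `[0%R, T]%classic < +oo)%E.
  by rewrite lebesgue_measure_itv/=; case: ifP => // _; rewrite -EFinB ltry.
have lD : ((@lebesgue_measure R \x P) D < +oo)%E.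
  have -> : (@lebesgue_measure R \x P)%E D =
      ((@lebesgue_measure R) `[0%R, T]%classic * P setT)%E.
    exact: product_measure1E.
  by rewrite probability_setT mule1.
pose I := ('I_(ep_size Phi) * 'I_(ep_size Phi))%type.
pose S (p : I) := `]ep_left p.1, ep_right p.1]%classic `&`
  `]ep_left p.2, ep_right p.2]%classic.
pose A (p : I) := ep_event p.1 `&` ep_event p.2.
pose En (p : I) : set (measurableTypeR R * Omega) := S p `*` A p.
have mS p : measurable (S p) by exact: measurableI.
have mA p : measurable (A p) by exact: measurableI.
have mEn p : measurable (En p).
  by apply: measurableX; [exact: mS|exact: mA].
transitivity (\int[(@lebesgue_measure R \x P)%E]_(sw in D)
    (\sum_(p <- index_enum I)
      \1_(En p) sw * ipL2 rho (ep_val p.1) (ep_val p.2))%:E)%E.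
  apply: eq_integral => -[s w] _ /=.
  rewrite sqnormL2E//; last exact: L2_elementary_fun.
  congr EFin; rewrite /elementary_fun ip_sum2; last 2 first.
  - by move=> i; exact: (ep_L2 i).
  - by move=> i; exact: (ep_L2 i).
  apply: eq_bigr => p _; congr (_ * _).
  rewrite /En /S /A !indicE in_setX/= !in_setI.
  by do 4 case: (_ \in _); rewrite /= ?(mul0r, mulr0, mulr1).
rewrite (integral_step mD lD _ mEn); congr EFin.
apply: eq_bigr => p _; congr (_ * _).
have -> : En p `&` D = (S p `&` `[0%R, T]%classic) `*` A p.
  by apply/seteqP; split => -[s w] /= [] [] ? ?; [move=> [? _]|move=> ?].
have mST : measurable (S p `&` `[0%R, T]%classic) by exact: measurableI.
transitivity (fine ((@lebesgue_measure R) (S p `&` `[0%R, T]%classic) * P (A p))%E).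
  by congr fine; exact: product_measure1E.
rewrite fineM ?fin_num_measure//; first by rewrite mulrC.
rewrite ge0_fin_numE//.
apply: le_lt_trans lT.
by apply: le_measure; rewrite ?inE//; exact: measurableI.
Qed.

(** Distinct Brownian motions contribute orthogonally, so the weights a_k are
    summed rather than their square roots. *)
Lemma ito_isometry_sum (n : nat) (Phi : nat -> ep) : (forall k, 0 <= a k) ->
  let X w x := \sum_(k < n) Num.sqrt (a k) *
    elementary_int (Phi k) (beta k) T w x in
  measurable_fun setT (fun w => sqnormL2 rho (X w)) /\
  (\int[P]_w sqnormL2 rho (X w) =
    (\sum_(k < n) a k * (m2 * ep_energy (Phi k)))%:E)%E.
Proof.
move=> a0 X.
have LX w : L2 rho (X w).
  apply: (L2_sum mrho rho0 (index_enum 'I_n)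
    (fun k : 'I_n => Num.sqrt (a k))
    (u := fun (k : 'I_n) x => elementary_int (Phi k) (beta k) T w x)) => k.
  exact: L2_elementary_int.
pose f (p : 'I_n * 'I_n) w := Num.sqrt (a p.1) * Num.sqrt (a p.2) *
  ipL2 rho (elementary_int (Phi p.1) (beta p.1) T w)
    (elementary_int (Phi p.2) (beta p.2) T w).
have XE w : sqnormL2 rho (X w) = (\sum_p f p w)%:E.
  rewrite sqnormL2E//; congr EFin; rewrite ip_sum2//.
  - by move=> i; exact: L2_elementary_int.
  - by move=> i; exact: L2_elementary_int.
have fi p : P.-integrable setT (fun w => (f p w)%:E).
  exact: (integrableZl measurableT _ (ip_int_integrable _ _ _ _)).
have fsi := integrable_Rsum (index_enum _) measurableT fi.
split; first by under eq_fun do rewrite XE; exact: measurable_int fsi.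
under eq_integral do rewrite XE.
transitivity ((\int[P]_w (\sum_p f p w))%:E)%R.
  by rewrite /Rintegral fineK//; exact: integrable_fin_num fsi.
congr EFin; rewrite (Rintegral_sum _ measurableT fi).
rewrite -(pair_big xpredT xpredT (fun k j => \int[P]_w f (k, j) w))/=.
apply: eq_bigr => k _; rewrite (bigD1 k)//= big1 ?addr0.
  rewrite /f/= RintegralZl//; last exact: ip_int_integrable.
  rewrite -expr2 sqr_sqrtr//; move: (a0 k); rewrite le_eqVlt => /orP[/eqP <-|ak].
    by rewrite !mul0r.
  by rewrite sq_int_expectation.
move=> j jk; rewrite /f/= RintegralZl//; last exact: ip_int_integrable.
have := a0 k; have := a0 j; rewrite !le_eqVlt.
move=> /orP[/eqP <-|aj]; first by rewrite sqrtr0 mulr0 mul0r.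
move=> /orP[/eqP <-|ak]; first by rewrite sqrtr0 !mul0r.
by rewrite ip_int_expectation ?mulr0// eq_sym.
Qed.

End ito_isometry.

(** * Bounds and measurability for the data *)

Section noise_and_data.
Context {R : realType} {d : nat}.
Local Notation Rd := 'rV[R]_d.
Local Notation leb := (lebesgue_rV d).

Lemma Lnorm_oo_ae (f : Rd -> R) (c : R) :
  ('N[leb]_+oo[EFin \o f] <= c%:E)%E -> {ae leb, forall x, `|f x| <= c}.
Proof.
(* On a null space the norm is 0 by definition, and so is every property almost
   everywhere true. *)
rewrite unlock; case: ifPn => [_ /ess_supP|].
  by apply: filterS => x; rewrite /= lee_fin.
rewrite -leNgt => leb0 _; exists setT; split => //.
by apply/eqP; rewrite eq_le leb0 measure_ge0.
Qed.

Lemma Lfun_bounds (f : Rd -> R) : f \in Lfun leb 1%E -> f \in Lfun leb +oo%E ->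
  (forall x, 0 <= f x) -> measurable_fun setT f /\
  exists M : R, [/\ 0 < M, {ae leb, forall x, f x <= M} &
    (\int[leb]_x (f x)%:E <= M%:E)%E].
Proof.
move=> /Lfun1_integrable fi foo f0.
have mf : measurable_fun setT f by apply/measurable_EFinP; exact: measurable_int fi.
split => //.
have noo : ('N[leb]_+oo[EFin \o f] < +oo)%E.
  by move: foo; rewrite inE => /andP[_]; rewrite inE.
have n0 : (0 <= 'N[leb]_+oo[EFin \o f])%E by exact: Lnorm_ge0.
have i0 : (0 <= \int[leb]_x (f x)%:E)%E.
  by apply: integral_ge0 => x _; rewrite lee_fin.
exists (fine ('N[leb]_+oo[EFin \o f])%E + fine (\int[leb]_x (f x)%:E)%E + 1).
split.
- by rewrite ltr_wpDl// addr_ge0// fine_ge0.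
- have : ('N[leb]_+oo[EFin \o f] <= (fine 'N[leb]_+oo[EFin \o f])%:E)%E.
    by rewrite fineK// ge0_fin_numE.
  move=> /Lnorm_oo_ae; apply: filterS => x; rewrite ger0_norm// => /le_trans; apply.
  by rewrite -addrA lerDl addr_ge0// fine_ge0.
- rewrite -[leLHS]fineK; last first.
    exact: integrable_fin_num fi.
  by rewrite lee_fin addrAC lerDr addr_ge0// fine_ge0.
Qed.

(** The constant grows with n, which is fixed before the small errors to which
    the estimate is applied. *)
Lemma sqnormL2_sum (rho : Rd -> R) (n : nat) (c : nat -> R)
    (v : nat -> Rd -> R) :
  measurable_fun setT rho -> (forall x, 0 <= rho x) ->
  (forall k, measurable_fun setT (v k)) ->
  (sqnormL2 rho (fun x => (\sum_(k < n) c k * v k x)%R) <=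
   (2 ^+ n)%:E * \sum_(k < n) (c k ^+ 2)%:E * sqnormL2 rho (v k))%E.
Proof.
move=> mrho rho0 mv.
have term0 k : (0 <= (c k ^+ 2)%:E * sqnormL2 rho (v k))%E.
  by rewrite mule_ge0 ?lee_fin ?sqr_ge0 ?sqnormL2_ge0.
elim: n => [|n IH].
  rewrite big_ord0 mule0 /sqnormL2 integral0_eq// => x _.
  by rewrite big_ord0 expr0n mul0r.
have mcv k : measurable_fun setT (fun x => c k * v k x).
  exact: measurable_funM.
have ms : measurable_fun setT (fun x => \sum_(k < n) c k * v k x).
  by apply: measurable_sum => k; exact: mcv.
rewrite (_ : (fun _ => _) = (fun x => \sum_(k < n) c k * v k x) \+
  (fun x => c n * v n x)); last first.
  by apply/funext => x /=; rewrite big_ord_recr.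
apply: le_trans (sqnormL2D mrho rho0 ms (mcv n)) _.
rewrite sqnormL2Z// big_ord_recr/=.
have B0 : (0 <= \sum_(k < n) (c k ^+ 2)%:E * sqnormL2 rho (v k))%E.
  by apply: sume_ge0 => k _; exact: term0.
rewrite (ge0_muleDr _ B0 (term0 n)) leeD//.
  by rewrite exprS EFinM -muleA; apply: lee_wpmul2l.
by apply: lee_wpmul2r => //; rewrite lee_fin exprS ler_peMr// exprn_ege1// ler1n.
Qed.

Lemma measurable_heat_decay_sub (D : set R) (t : R) :
  measurable_fun D (fun s => heat_decay (t - s)).
Proof.
apply: measurable_funTS; apply: measurable_funM => //.
apply: (measurableT_comp (measurable_powR _)).
by do 2 apply: measurable_funD => //.
Qed.

Lemma measurable_nemytskii (g : Rd -> R -> R) (v : Rd -> R) :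
  measurable_fun setT (fun p : Rd * R => g p.1 p.2) -> measurable_fun setT v ->
  measurable_fun setT (fun y => g y (v y)).
Proof.
move=> mg mv.
have mp : measurable_fun setT (fun y : Rd => (y, v y)).
  by apply/measurable_fun_pairP; split; [exact: measurable_id|exact: mv].
exact: (measurableT_comp mg mp).
Qed.

Definition empty_process dO (Omega : measurableType dO) (rho : Rd -> R)
    (F : R -> set (set Omega)) : elementary_process rho F.
Proof.
by apply: (@ElementaryProcess _ _ _ _ rho F 0 (fun=> 0) (fun=> 0)
  (fun=> set0) (fun=> cst 0)) => -[].
Defined.

End noise_and_data.

(** * The stochastic convolution *)

Section stochastic_convolution_bound.
Context {R : realType} {d : nat} {dO : measure_display}.
Context {Omega : measurableType dO}.
Local Notation Rd := 'rV[R]_d.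
Variable P : probability Omega R.
Variable F : R -> set (set Omega).
Hypothesis hF : right_continuous_filtration F.
Variable rho : Rd -> R.
Hypothesis mrho : measurable_fun setT rho.
Hypothesis rho0 : forall x, 0 <= rho x.
Local Notation ep := (elementary_process rho F).

(** The deterministic bound H on the integrand controls the energy of any
    elementary process within distance 1 of it in mean square. *)
Lemma ito_integral_approx (b : R -> Omega -> R) (t B delta : R)
    (phi : R -> Omega -> Rd -> R) (I : Omega -> Rd -> R) (H : R -> R) :
  is_ito_integral P rho F b t phi I -> 0 < delta ->
  measurable_fun `[0, t] H ->
  (forall s w, 0 <= s <= t ->
    0 <= H s /\ (sqnormL2 rho (phi s w) <= (H s)%:E)%E) ->
  (\int[lebesgue_measure]_(s in `[0%R, t]) (H s)%:E <= B%:E)%E ->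
  exists (Phi : ep) (h : Omega -> \bar R), [/\ measurable_fun setT h,
    forall w, (sqnormL2 rho (elementary_int Phi b t w \- I w)%R <= h w)%E,
    (\int[P]_w h w <= delta%:E)%E & ep_energy P t Phi <= 2 * (1 + B)].
Proof.
move=> [Lphi LI [Phi [PhiI intI]]] delta0 mH phiH HB.
near \oo => n.
have [h [mh Ih hdelta]] : exists h, [/\ measurable_fun setT h,
    forall w, setT w ->
      (sqnormL2 rho (elementary_int (Phi n) b t w \- I w)%R <= h w)%E
    & (\int[P]_w h w < delta%:E)%E].
  by near: n; exact: upint_near_majorant intI delta0.
pose D : set (measurableTypeR R * Omega) := `[0, t]%classic `*` setT.
have mD : measurable D by exact: measurableX.
have [g [mg phig g1]] : exists g : measurableTypeR R * Omega -> \bar R,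
    [/\ measurable_fun D g, forall sw, D sw -> (sqnormL2 rho
      (elementary_fun (Phi n) sw.1 sw.2 \- phi sw.1 sw.2)%R <= g sw)%E
    & (\int[(@lebesgue_measure R \x P)%E]_(sw in D) g sw < 1)%E].
  by near: n; exact: upint_near_majorant PhiI ltr01.
exists (Phi n), h; split => //.
- by move=> w; exact: Ih.
- exact: ltW.
have g0 sw : D sw -> (0 <= g sw)%E.
  by move=> Dsw; apply: le_trans (phig sw Dsw); exact: sqnormL2_ge0.
(* H is extended by 0 outside [0, t] to apply Tonelli on the whole product. *)
pose H0 : measurableTypeR R -> \bar R := (fun s => (H s)%:E) \_ `[0, t]%classic.
have mH0 : measurable_fun setT H0.
  by apply/(measurable_restrictT _ _).1 => //; exact/measurable_EFinP.
have H00 s : (0 <= H0 s)%E.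
  rewrite /H0 patchE; case: ifPn => // /set_mem; rewrite /= in_itv/= => st.
  by rewrite lee_fin; exact: (phiH s point st).1.
have mH1 : measurable_fun setT (H0 \o fst : measurableTypeR R * Omega -> \bar R).
  exact: measurableT_comp mH0 measurable_fst.
have intH : (\int[(@lebesgue_measure R \x P)%E]_(sw in D) (H0 sw.1) <= B%:E)%E.
  apply: (@le_trans _ _ (\int[(@lebesgue_measure R \x P)%E]_sw (H0 sw.1))%E).
    by apply: ge0_subset_integral => // sw _; exact: H00.
  rewrite (@fubini_tonelli1 _ _ _ _ _ _ _ (H0 \o fst))//.
  have cstE (c : \bar R) : (\int[P]_w c = c)%E.
    transitivity (c * P setT)%E; first exact: integral_cst.
    by rewrite probability_setT mule1.
    rewrite (eq_integral H0); last by move=> s _; exact: (cstE (H0 s)).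
    by rewrite /H0 -integral_mkcond.
  by move=> sw; exact: H00.
rewrite -lee_fin -(ep_energyE P hF t mrho rho0).
apply: (@le_trans _ _ (\int[(@lebesgue_measure R \x P)%E]_(sw in D)
    (2%:E * g sw + 2%:E * H0 sw.1))%E).
  apply: le_lower_integral => -[s w] Dsw; first exact: sqnormL2_ge0.
  have st : 0 <= s <= t by move: Dsw => -[] /=; rewrite in_itv.
  have Lf := L2_elementary_fun mrho rho0 (Phi n) s w.
  have Lp := Lphi s w st.
  rewrite (_ : elementary_fun (Phi n) _ _ =
    (elementary_fun (Phi n) s w \- phi s w) \+ phi s w)%R; last first.
    by apply/funext => x /=; rewrite subrK.
  have Lfp := L2B mrho rho0 Lf Lp.
  apply: le_trans (sqnormL2D mrho rho0 Lfp.1 Lp.1) _; apply: leeD.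
    by apply: lee_wpmul2l => //; exact: phig Dsw.
  apply: lee_wpmul2l => //; rewrite /H0 patchE mem_set; last by rewrite /= in_itv.
  exact: (phiH s w st).2.
have mHD : measurable_fun D (fun sw => H0 sw.1) by exact: measurable_funS mH1.
rewrite ge0_integralD//; last 4 first.
- by move=> sw Dsw; rewrite mule_ge0// g0.
- exact: (emeasurable_funM (measurable_cst _) mg).
- by move=> sw _; rewrite mule_ge0.
- exact: (emeasurable_funM (measurable_cst _) mHD).
rewrite (ge0_integralZl_EFin _ mD g0 mg)//.
rewrite (ge0_integralZl_EFin _ mD (fun sw _ => H00 sw.1) mHD)//.
rewrite mulrDr (EFinD (2 * 1)); apply: leeD.
  by rewrite (EFinM 2); apply: lee_wpmul2l => //; exact: ltW.
by rewrite (EFinM 2); apply: lee_wpmul2l.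
Unshelve. all: by end_near. Qed.

End stochastic_convolution_bound.

Section stochastic_convolution_le.
Context {R : realType} {d : nat} {dO : measure_display}.
Context {Omega : measurableType dO}.
Local Notation Rd := 'rV[R]_d.
Variable P : probability Omega R.
Variables (e : nat -> Rd -> R) (a : nat -> R) (beta : nat -> R -> Omega -> R).
Variables (W : R -> Omega -> Rd -> R) (F : R -> set (set Omega)).
Hypothesis he : orthonormal_basis e.
Hypothesis ha0 : forall k, 0 <= a k.
Hypothesis hbeta : forall k, wiener_process P (beta k).
Hypothesis hindep : mutually_independent P (fun k => sigma_of_process (beta k)).
Hypothesis hW : is_noise P a beta e W.
Hypothesis hF : right_continuous_filtration F.
Hypothesis hWF : noise_adapted P F W.
Variable rho : Rd -> R.
Hypothesis mrho : measurable_fun setT rho.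
Hypothesis rho0 : forall x, 0 <= rho x.
Local Notation ep := (elementary_process rho F).

Let m2 := @normal_m2 R.

(** First n is chosen so that the partial sum of index n is within distance 1 of
    Z, then each of its Ito integrals is approximated within delta by that of an
    elementary process. The isometry bounds the resulting sum by the total mass A
    of the weights, so n disappears from the estimate. *)
Lemma stochastic_convolution_le (t A B : R) (psi : R -> Omega -> Rd -> R)
    (Z : Omega -> Rd -> R) (H : R -> R) :
  0 <= t -> (forall n, \sum_(k < n) a k <= A) -> 0 <= B ->
  is_stochastic_convolution P rho F a beta e t psi Z ->
  measurable_fun `[0, t] H ->
  (forall k s w, 0 <= s <= t -> 0 <= H s /\
    (sqnormL2 rho (heat_semigroup (t - s) (fun y => (psi s w y * e k y)%R))
      <= (H s)%:E)%E) ->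
  (\int[lebesgue_measure]_(s in `[0%R, t]) (H s)%:E <= B%:E)%E ->
  exists h : Omega -> \bar R, [/\ measurable_fun setT h,
    forall w, (sqnormL2 rho (Z w) <= h w)%E &
    (\int[P]_w h w <= (6 + 4 * (A * (m2 * (2 * (1 + B)))))%:E)%E].
Proof.
move=> t0 aA B0 [LZ [I [Iito Icvg]]] mH psiH HB.
have A0 : 0 <= A by have := aA 0%N; rewrite big_ord0.
have m20 : 0 <= m2.
  by apply: Rintegral_ge0 => x _; rewrite mulr_ge0 ?sqr_ge0 ?normal_pdf_ge0.
have [n [hZ [mhZ ZhZ hZ1]]] : exists n (h : Omega -> \bar R),
    [/\ measurable_fun setT h, forall w, setT w -> (sqnormL2 rho
      (fun x => \sum_(k < n) Num.sqrt (a k) * I k w x - Z w x)%R <= h w)%E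
    & (\int[P]_w h w < 1)%E].
  near \oo => n; exists n.
  by near: n; exact: upint_near_majorant Icvg ltr01.
(* When a_k = 0 the k-th term has weight 0 and I k is an arbitrary function. *)
pose I' k w : Rd -> R := if 0 < a k then I k w else cst 0.
(* The n errors, amplified by the constant of sqnormL2_sum, then add up to at
   most 1. *)
pose delta : R := (2 ^+ n * (A + 1))^-1.
have pn0 : (0 < 2 ^+ n :> R) by rewrite exprn_gt0.
have delta0 : 0 < delta by rewrite invr_gt0 mulr_gt0// ltr_wpDl.
have approx k : exists Ph : ep * (Omega -> \bar R),
    [/\ measurable_fun setT Ph.2,
    forall w, (sqnormL2 rho (elementary_int Ph.1 (beta k) t w \- I' k w)%R
      <= Ph.2 w)%E,
    (\int[P]_w Ph.2 w <= delta%:E)%E &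
    ep_energy P t Ph.1 <= 2 * (1 + B)].
  have [ak|ak] := boolP (0 < a k).
    have [Phi [h [mh Phih hd En]]] := ito_integral_approx hF mrho rho0
      (Iito k ak) delta0 mH (psiH k) HB.
    by exists (Phi, h); split => // w; rewrite /I' ak.
  exists (empty_process rho F, cst 0%E); split => //=.
  - move=> w; rewrite /I' (negbTE ak) /sqnormL2 integral0_eq// => x _.
    by rewrite /= /elementary_int big_ord0 subrr expr0n mul0r.
  - by rewrite integral0 lee_fin ltW.
  - rewrite /ep_energy big1 ?mulr_ge0 ?addr_ge0//.
    by move=> -[[]].
have [Phi Phih] := choice approx.
have LI' k w : L2 rho (I' k w).
  rewrite /I'; case: ifPn => [ak|_]; last exact: L2_cst0.
  by have [_ LI _] := Iito k ak.
have LJ k w : L2 rho (elementary_int (Phi k).1 (beta k) t w).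
  exact: L2_elementary_int.
pose X w x := \sum_(k < n) Num.sqrt (a k) *
  elementary_int (Phi k).1 (beta k) t w x.
(* The partial sum of the Ito integrals is X - Y. *)
pose Y w x := \sum_(k < n) Num.sqrt (a k) *
  (elementary_int (Phi k).1 (beta k) t w \- I' k w) x.
have [mX EX] : measurable_fun setT (fun w => sqnormL2 rho (X w)) /\
    (\int[P]_w sqnormL2 rho (X w) =
      (\sum_(k < n) a k * (m2 * ep_energy P t (Phi k).1))%:E)%E.
  apply: (@ito_isometry_sum _ _ _ _ P a beta F m2 hF _ _ _ t t0 rho mrho rho0 n
    (fun k => (Phi k).1)) => //.
  - exact: integrable_incM.
  - exact: (inc_orthogonal he hbeta hW hF hWF).
  - exact: (inc_covariance_past he hbeta hindep hW hF hWF).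
have mD k w : measurable_fun setT (elementary_int (Phi k).1 (beta k) t w \- I' k w).
  exact: (L2B mrho rho0 (LJ k w) (LI' k w)).1.
have mXw w : measurable_fun setT (X w).
  apply: measurable_sum => k; apply: measurable_funM => //; exact: (LJ k w).1.
have mYw w : measurable_fun setT (Y w).
  by apply: measurable_sum => k; apply: measurable_funM.
pose hY w : \bar R := ((2 ^+ n)%:E * \sum_(k < n) (a k)%:E * (Phi k).2 w)%E.
have Ph0 k w : (0 <= (Phi k).2 w)%E.
  by have [_ h _ _] := Phih k; apply: le_trans (h w); exact: sqnormL2_ge0.
have term0 k w : (0 <= (a k)%:E * (Phi k).2 w)%E by rewrite mule_ge0 ?lee_fin.
have mterm k : measurable_fun setT (fun w => (a k)%:E * (Phi k).2 w)%E.
  by have [h _ _ _] := Phih k; exact: (emeasurable_funM (measurable_cst _) h).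
have msum : measurable_fun setT (fun w => \sum_(k < n) (a k)%:E * (Phi k).2 w)%E.
  by apply: emeasurable_sum => k; exact: mterm.
have sum0 w : (0 <= \sum_(k < n) (a k)%:E * (Phi k).2 w)%E.
  by apply: sume_ge0 => k _; exact: term0.
have mhY : measurable_fun setT hY by exact: (emeasurable_funM (measurable_cst _) msum).
have hY0 w : (0 <= hY w)%E by rewrite mule_ge0// lee_fin ltW.
have YhY w : (sqnormL2 rho (Y w) <= hY w)%E.
  apply: le_trans (sqnormL2_sum n (fun k => Num.sqrt (a k)) mrho rho0
    (fun k => mD k w)) _.
  apply: lee_wpmul2l; first by rewrite lee_fin ltW.
  apply: lee_sum => k _; rewrite sqr_sqrtr//; apply: lee_wpmul2l.
    by rewrite lee_fin.
  by have [_ h _ _] := Phih k; exact: h.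
have hY1 : (\int[P]_w hY w <= 1%:E)%E.
  rewrite (ge0_integralZl_EFin _ measurableT (fun w _ => sum0 w) msum (ltW pn0)).
  rewrite ge0_integral_sum//.
  apply: (@le_trans _ _ ((2 ^+ n)%:E * \sum_(k < n) (a k * delta)%:E)%E).
    apply: lee_wpmul2l; first by rewrite lee_fin ltW.
    apply: lee_sum => k _; have [h _ hd _] := Phih k.
    rewrite ge0_integralZl_EFin// EFinM; apply: lee_wpmul2l => //.
    by rewrite lee_fin.
  rewrite sumEFin -mulr_suml -EFinM lee_fin /delta mulrA.
  rewrite ler_pdivrMr ?mulr_gt0 ?ltr_wpDl// mul1r ler_pM2l//.
  by rewrite (le_trans (aA n))// lerDl.
have hZ0 w : (0 <= hZ w)%E by apply: le_trans (ZhZ w Logic.I); exact: sqnormL2_ge0.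
pose h w : \bar R := (2%:E * hZ w + 4%:E * hY w + 4%:E * sqnormL2 rho (X w))%E.
have mh1 : measurable_fun setT (fun w => 2%:E * hZ w)%E.
  exact: (emeasurable_funM (measurable_cst _) mhZ).
have mh2 : measurable_fun setT (fun w => 4%:E * hY w)%E.
  exact: (emeasurable_funM (measurable_cst _) mhY).
have mh3 : measurable_fun setT (fun w => 4%:E * sqnormL2 rho (X w))%E.
  exact: (emeasurable_funM (measurable_cst _) mX).
have mh12 := emeasurable_funD mh1 mh2.
have X0 w : (0 <= sqnormL2 rho (X w))%E by exact: sqnormL2_ge0.
exists h; split; first exact: emeasurable_funD.
  move=> w; pose S x := \sum_(k < n) Num.sqrt (a k) * I k w x.
  have SE : S = X w \- Y w.
    apply/funext => x; rewrite /S /X /Y /= -sumrB; apply: eq_bigr => k _.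
    rewrite mulrBr opprB addrC subrK /I'.
    have [ak|ak] := boolP (0 < a k) => //.
    have -> : a k = 0 by apply/eqP; rewrite eq_le ha0 andbT leNgt.
    by rewrite sqrtr0 !mul0r.
  have mS : measurable_fun setT S by rewrite SE; exact: measurable_funB.
  have mZw : measurable_fun setT (Z w) by exact: (LZ w).1.
  have -> : Z w = (fun x => -1 * (S \- Z w) x) \+ S.
    by apply/funext => x /=; rewrite mulN1r opprB subrK.
  have mSZ : measurable_fun setT (S \- Z w) by exact: measurable_funB.
  have mNSZ : measurable_fun setT (fun x => -1 * (S \- Z w) x).
    exact: measurable_funM.
  apply: le_trans (sqnormL2D mrho rho0 mNSZ mS) _.
  rewrite sqnormL2Z// sqrrN expr1n mul1e /h -addeA; apply: leeD.
    by apply: lee_wpmul2l => //; exact: ZhZ.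
  have SXY : (sqnormL2 rho S <= 2%:E * hY w + 2%:E * sqnormL2 rho (X w))%E.
    rewrite SE (_ : X w \- Y w = (fun x => -1 * Y w x) \+ X w); last first.
      by apply/funext => x /=; rewrite mulN1r addrC.
    have mNY : measurable_fun setT (fun x => -1 * Y w x) by exact: measurable_funM.
    apply: le_trans (sqnormL2D mrho rho0 mNY (mXw w)) _.
    rewrite sqnormL2Z// sqrrN expr1n mul1e; apply: leeD => //.
    by apply: lee_wpmul2l => //; exact: YhY.
  have -> : (4%:E = 2%:E * 2%:E :> \bar R)%E by rewrite -EFinM; congr EFin; ring.
  rewrite -!muleA -ge0_muleDr ?mule_ge0//.
  exact: lee_wpmul2l.
have h1_ge0 w : (0 <= 2%:E * hZ w)%E by exact: mule_ge0.
have h2_ge0 w : (0 <= 4%:E * hY w)%E by exact: mule_ge0.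
have h3_ge0 w : (0 <= 4%:E * sqnormL2 rho (X w))%E by exact: mule_ge0.
rewrite (ge0_integralD _ measurableT (fun w _ => adde_ge0 (h1_ge0 w) (h2_ge0 w))
  mh12 (fun w _ => h3_ge0 w) mh3).
rewrite (ge0_integralD _ measurableT (fun w _ => h1_ge0 w) mh1
  (fun w _ => h2_ge0 w) mh2).
rewrite (ge0_integralZl_EFin _ measurableT (fun w _ => hZ0 w) mhZ)//.
rewrite (ge0_integralZl_EFin _ measurableT (fun w _ => hY0 w) mhY)//.
rewrite (ge0_integralZl_EFin _ measurableT (fun w _ => X0 w) mX)// EX.
have -> : 6 + 4 * (A * (m2 * (2 * (1 + B)))) =
  (2 * 1 + 4 * 1) + 4 * (A * (m2 * (2 * (1 + B)))) by ring.
rewrite (EFinD (2 * 1 + 4 * 1)) (EFinD (2 * 1)) (EFinM 2 1) (EFinM 4 1) (EFinM 4).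
apply: leeD; first apply: leeD.
- by apply: lee_wpmul2l => //; exact: ltW.
- by apply: lee_wpmul2l.
apply: lee_wpmul2l => //; rewrite lee_fin.
apply: (@le_trans _ _ (\sum_(k < n) a k * (m2 * (2 * (1 + B))))).
  apply: ler_sum => k _; rewrite ler_wpM2l// ler_wpM2l//.
  by have [_ _ _ h'] := Phih k.
by rewrite -mulr_suml ler_wpM2r// !mulr_ge0// addr_ge0.
Unshelve. all: by end_near. Qed.

End stochastic_convolution_le.

(** * The uniform bound *)

Lemma mule2_regroup (R : realType) (q k : R) (s z : \bar R) :
  0 <= q -> 0 <= k -> (0 <= s)%E -> (0 <= z)%E ->
  (2%:E * (2%:E * (q%:E * s) + 2%:E * (2%:E * k%:E + 2%:E * z)) =
    (4 * q)%:E * s + ((8 * k)%:E + 8%:E * z))%E.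
Proof.
move=> q0 k0 s0 z0.
have q0' : (0 <= 2%:E * (q%:E * s))%E by rewrite !mule_ge0// lee_fin.
have k0' : (0 <= 2%:E * k%:E)%E by rewrite mule_ge0// lee_fin.
have z0' : (0 <= 2%:E * z)%E by rewrite mule_ge0.
rewrite (ge0_muleDr _ k0' z0') ge0_muleDr//; last first.
  by apply: adde_ge0; apply: mule_ge0.
rewrite ge0_muleDr; [|by apply: mule_ge0..].
rewrite !muleA -!EFinM.
have -> : 2 * 2 * 2 = 8 :> R by ring.
by have -> : 2 * 2 = 4 :> R by ring.
Qed.

Theorem theorem1 (R : realType) (d : nat) (hd : (3 <= d)%N)
  (rho : 'rV[R]_d -> R) (hrho : admissible_weight rho)
  (dO : measure_display) (Omega : measurableType dO) (P : probability Omega R)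
  (e : nat -> 'rV[R]_d -> R) (he : orthonormal_basis e)
  (he1 : forall k, ('N[lebesgue_rV d]_+oo[EFin \o e k] <= 1)%E)
  (a : nat -> R) (ha0 : forall k, 0 <= a k) (ha : cvgn (series a))
  (beta : nat -> R -> Omega -> R)
  (hbeta : forall k, wiener_process P (beta k))
  (hindep : mutually_independent P (fun k => sigma_of_process (beta k)))
  (W : R -> Omega -> 'rV[R]_d -> R) (hW : is_noise P a beta e W)
  (F : R -> set (set Omega)) (hF : right_continuous_filtration F)
  (hWF : noise_adapted P F W)
  (f sigma : 'rV[R]_d -> R -> R)
  (mf : measurable_fun setT (fun p : 'rV[R]_d * R => f p.1 p.2))
  (msigma : measurable_fun setT (fun p : 'rV[R]_d * R => sigma p.1 p.2))
  (hsigma : exists c sigma0 : R, [/\ 0 < c, 0 < sigma0,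
     forall x u1 u2, `|sigma x u1 - sigma x u2| <= c * `|u1 - u2|
   & forall x u, `|sigma x u| <= sigma0])
  (hf : exists2 c : R, 0 < c &
     forall x u1 u2, `|f x u1 - f x u2| <= c * `|u1 - u2|)
  (hphi : exists phi : 'rV[R]_d -> R,
     [/\ phi \in Lfun (lebesgue_rV d) 1%E,
         phi \in Lfun (lebesgue_rV d) +oo%E
       & forall x u, `|f x u| <= phi x])
  (u : R -> Omega -> 'rV[R]_d -> R)
  (hu : mild_solution P rho F a beta e f sigma u)
  (hu0 : (\int[P]_w sqnormL2 (cst 1%R) (u 0%R w) < +oo)%E) :
  (ereal_sup [set \int[P]_w sqnormL2 rho (u t w) | t in [set t : R | 0 <= t]%R]
    < +oo)%E.
Proof.
have [rho0 _ rho1 rhooo _] := hrho.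
have [mrho [Q [Q0 rhoQ intQ]]] := Lfun_bounds rho1 rhooo rho0.
have {hphi} [phi [phi1 phioo fphi]] := hphi.
have phi0 x : 0 <= phi x by apply: le_trans (fphi x 0).
have [mphi [Mphi [Mphi0 phiM intphi]]] := Lfun_bounds phi1 phioo phi0.
have {hsigma} [_ [sigma0 [_ sigma0_gt0 _ sigma_le]]] := hsigma.
have m1 : measurable_fun setT (cst 1 : 'rV[R]_d -> R) by exact: measurable_cst.
have one0 (x : 'rV[R]_d) : 0 <= (cst 1 : 'rV[R]_d -> R) x by exact: ler01.
have [Le e1 _] := he.
have me k : measurable_fun setT (e k) by exact: (Le k).1.
have e2 k : (\int[lebesgue_rV d]_y (e k y ^+ 2)%:E = 1)%E.
  rewrite (_ : \int[_]_y _ = sqnormL2 (cst 1%R) (e k))%E; last first.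
    by apply: eq_integral => y _; rewrite /= mulr1.
  rewrite sqnormL2E//; congr EFin; have := e1 k k; rewrite eqxx mulr1n.
  by apply: etrans; apply: eq_Rintegral => y _; rewrite /= mulr1.
pose A := limn (series a).
have aA n : \sum_(k < n) a k <= A.
  rewrite -(big_mkord xpredT a) -[leLHS]/(series a n).
  apply: nondecreasing_cvgn_le => //.
  by apply: nondecreasing_series => k _ _; exact: ha0.
(* The factors 8 bound the time integral of the decay rate; BD bounds that of
   the H-norm of the drift and BZ that of the squared H-norm of each noise
   coefficient. *)
pose BD := 8 * (Mphi * Num.sqrt Q).
pose KD := 2 * (BD + 1) ^+ 2 + 2.
pose BZ := 8 * (sigma0 ^+ 2 * Q).
pose KZ := 6 + 4 * (A * (@normal_m2 R * (2 * (1 + BZ)))).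
have BD0 : 0 <= BD by rewrite !mulr_ge0// ?ltW// sqrtr_ge0.
have BZ0 : 0 <= BZ by rewrite !mulr_ge0// ?sqr_ge0// ltW.
have KD0 : 0 <= KD by rewrite addr_ge0// mulr_ge0// sqr_ge0.
have intdecay (t c : R) : 0 <= t -> 0 <= c ->
    (\int[lebesgue_measure]_(s in `[0%R, t]) (c * heat_decay (t - s))%:E
      <= (8 * c)%:E)%E.
  move=> t0 c0; under eq_integral do rewrite (EFinM c).
  rewrite ge0_integralZl_EFin//.
  - by rewrite mulrC EFinM; apply: lee_wpmul2l => //; exact: integral_heat_decay.
  - by move=> s _; rewrite lee_fin heat_decay_ge0.
  - by apply/measurable_EFinP; exact: measurable_heat_decay_sub.
have {}hu := hu; case: hu => hu_rand hu_mild.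
have Lu t w : 0 <= t -> L2 rho (u t w) by move=> t0; exact: (hu_rand t t0).1.
pose c0 : \bar R := (\int[P]_w sqnormL2 (cst 1%R) (u 0%R w))%E.
pose K : \bar R := ((4 * Q)%:E * c0 + (8 * KD + 8 * KZ)%:E)%E.
apply: (@le_lt_trans _ _ K); last first.
  rewrite lte_add_pinfty ?ltry// lte_mul_pinfty// lee_fin.
  by rewrite mulr_ge0// ltW.
apply: ge_ereal_sup => _ [t /= t0 <-].
have [D [Z [aeD convZ aeu]]] := hu_mild t t0.
have mf' s w : 0 <= s -> measurable_fun setT (fun y => f y (u s w y)).
  by move=> s0; apply: measurable_nemytskii => //; exact: (Lu s w s0).1.
have ms' s w : 0 <= s -> measurable_fun setT (fun y => sigma y (u s w y)).
  by move=> s0; apply: measurable_nemytskii => //; exact: (Lu s w s0).1.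
have [hZ [mhZ ZhZ hZK]] : exists h : Omega -> \bar R, [/\ measurable_fun setT h,
    forall w, (sqnormL2 rho (Z w) <= h w)%E & (\int[P]_w h w <= KZ%:E)%E].
  apply: (stochastic_convolution_le he ha0 hbeta hindep hW hF hWF mrho rho0
    t0 aA BZ0 convZ (H := fun s => (sigma0 ^+ 2 * Q) * heat_decay (t - s))).
  - by apply: measurable_funM => //; exact: measurable_heat_decay_sub.
  - move=> k s w /andP[s0 st]; split.
      by rewrite mulr_ge0 ?heat_decay_ge0// mulr_ge0 ?sqr_ge0// ltW.
    rewrite mulrAC; apply: (sqnormL2_heat_sq mrho rho0
      (psi := fun y => sigma0 ^+ 2 * e k y ^+ 2)) => //.
    + by rewrite subr_ge0.
    + by apply: measurable_funM => //; exact: ms'.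
    + by apply: measurable_funM => //; exact: measurable_funX.
    + move=> y; rewrite exprMn ler_wpM2r ?sqr_ge0// -real_normK ?num_real//.
      by rewrite ler_sqr ?nnegrE// ltW.
    + apply: filterS (Lnorm_oo_ae (he1 k)) => y ey.
      rewrite ler_piMr ?sqr_ge0// -real_normK ?num_real//.
      by rewrite expr_le1.
    + under eq_integral do rewrite EFinM.
      rewrite ge0_integralZl_EFin ?sqr_ge0//.
      * by rewrite e2 mule1.
      * by move=> y _; rewrite lee_fin sqr_ge0.
      * by apply/measurable_EFinP; exact: measurable_funX.
    + exact: sqr_ge0.
  - by rewrite /BZ; apply: intdecay => //; rewrite mulr_ge0 ?sqr_ge0// ltW.
have DK : {ae P, forall w, L2 rho (D w) /\ (sqnormL2 rho (D w) <= KD%:E)%E}.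
  apply: filterS aeD => w hD; split; first by have [] := hD.
  apply: (bochner_integral_le mrho rho0 hD BD0
    (H := fun s => (Mphi * Num.sqrt Q) * heat_decay (t - s))).
  - by apply: measurable_funM => //; exact: measurable_heat_decay_sub.
  - move=> s /andP[s0 st]; split.
      by rewrite mulr_ge0 ?heat_decay_ge0// mulr_ge0 ?sqrtr_ge0// ltW.
    rewrite mulrAC exprMn sqr_sqrtr ?(ltW Q0)//.
    apply: (sqnormL2_heat_abs mrho rho0 (psi := phi)) => //.
    + by rewrite subr_ge0.
    + exact: mf'.
    + exact: ltW.
  - by rewrite /BD; apply: intdecay => //; rewrite mulr_ge0 ?sqrtr_ge0// ltW.
have hZ0 w : (0 <= hZ w)%E by apply: le_trans (ZhZ w); exact: sqnormL2_ge0.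
pose h w : \bar R := ((8 * KD)%:E + 8%:E * hZ w)%E.
have mh8 : measurable_fun setT (fun w => 8%:E * hZ w)%E.
  exact: (emeasurable_funM (measurable_cst _) mhZ).
have h8_ge0 w : (0 <= 8%:E * hZ w)%E by exact: mule_ge0.
have KD8 : (0 <= (8 * KD)%:E :> \bar R)%E by rewrite lee_fin mulr_ge0.
have mcst8 : measurable_fun setT (fun _ : Omega => (8 * KD)%:E : \bar R).
  exact: measurable_cst.
have Q40 : 0 < 4 * Q by rewrite mulr_gt0.
apply: (@le_trans _ _ ((4 * Q)%:E * c0 + \int[P]_w h w)%E).
  apply: lower_integral_le => //.
  - by move=> w; exact: sqnormL2_ge0.
  - by move=> w; exact: sqnormL2_ge0.
  - by move=> w; rewrite adde_ge0.
  - exact: emeasurable_funD.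
  (* For a fixed w this is an estimate in H. *)
  apply: filterS2 DK aeu => w [LD DKw] u_eq.
  have mu0 : measurable_fun setT (u 0 w) by exact: (Lu 0 w (lexx _)).1.
  have mS := measurable_heat t mu0.
  have mDZ : measurable_fun setT (D w \+ Z w).
    by apply: measurable_funD; [exact: LD.1|exact: (convZ.1 w).1].
  pose X : 'rV[R]_d -> R := heat_semigroup t (u 0 w) \+ (D w \+ Z w).
  have mX : measurable_fun setT X by exact: measurable_funD.
  have mut : measurable_fun setT (u t w) by exact: (Lu t w t0).1.
  have uX : sqnormL2 rho (u t w \- X) = 0%E.
    by rewrite -u_eq; apply: eq_integral => x _; rewrite /X /= addrA.
  have -> : u t w = (u t w \- X) \+ X by apply/funext => x /=; rewrite subrK.
  apply: le_trans (sqnormL2D mrho rho0 (measurable_funB mut mX) mX) _.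
  rewrite uX mule0 add0e.
  have le_DZ : (sqnormL2 rho (D w \+ Z w)%R <= 2%:E * KD%:E + 2%:E * hZ w)%E.
    apply: le_trans (sqnormL2D mrho rho0 LD.1 (convZ.1 w).1) _.
    by apply: leeD; apply: lee_wpmul2l => //; exact: ZhZ.
  have le_S : (sqnormL2 rho (heat_semigroup t (u 0%R w))
      <= Q%:E * sqnormL2 (cst 1%R) (u 0%R w))%E.
    by apply: sqnormL2_heat_contraction => //; exact: ltW.
  have le_X : (sqnormL2 rho X <= 2%:E * (Q%:E * sqnormL2 (cst 1%R) (u 0%R w)) +
      2%:E * (2%:E * KD%:E + 2%:E * hZ w))%E.
    apply: le_trans (sqnormL2D mrho rho0 mS mDZ) _.
    by apply: leeD; apply: lee_wpmul2l.
  apply: le_trans (lee_wpmul2l _ le_X) _ => //.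
  rewrite /h mule2_regroup ?lee_fin ?(ltW Q0)//; exact: sqnormL2_ge0.
rewrite /K (EFinD (8 * KD)); apply: leeD => //.
rewrite ge0_integralD//; apply: leeD.
  have -> : (\int[P]__ (8 * KD)%:E = (8 * KD)%:E * P setT)%E.
    exact: integral_cst.
  by rewrite probability_setT mule1.
rewrite (ge0_integralZl_EFin _ measurableT (fun w _ => hZ0 w) mhZ)//.
by rewrite (EFinM 8); apply: lee_wpmul2l.
Qed.
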